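(* Let $n\geq 3$, $p,q>0$ with $pq>1$, $\alpha\in(0,n)$ and $\sigma_1,\sigma_2\in[0,\alpha)$, and let $u,v$ be bounded positive solutions of $$u(x)=\int_{\mathbb{R}^n}\frac{v(y)^q}{|x-y|^{n-\alpha}|y|^{\sigma_1}}\,dy,\qquad v(x)=\int_{\mathbb{R}^n}\frac{u(y)^p}{|x-y|^{n-\alpha}|y|^{\sigma_2}}\,dy,\qquad x\in\mathbb{R}^n.$$ Then: (i) For any $\theta_1<q_0$ and $\theta_2<p_0$, there does not exist a constant $c>0$ such that either $u(x)\geq c(1+|x|)^{-\theta_1}$ (for all $x$) or $v(x)\geq c(1+|x|)^{-\theta_2}$ (for all $x$). (ii) If $u,v$ are not integrable solutions, then for any $\theta_3>q_0$ and $\theta_4>p_0$ there does not exist a constant $C>0$ such that either $u(x)\leq C(1+|x|)^{-\theta_3}$ or $v(x)\leq C(1+|x|)^{-\theta_4}$. (iii) If $u,v$ are not integrable solutions but are decaying solutions, then $u(x)\simeq|x|^{-q_0}$ and $v(x)\simeq|x|^{-p_0}$ as $|x|\to\infty$.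
   Context: Define $$p_0=\frac{\alpha(1+p)-(\sigma_2+\sigma_1p)}{pq-1},\qquad q_0=\frac{\alpha(1+q)-(\sigma_1+\sigma_2q)}{pq-1},\qquad r_0=\frac{n}{q_0},\qquad s_0=\frac{n}{p_0}.$$ A positive solution $u,v$ is integrable if $u\in L^{r_0}(\mathbb{R}^n)$ and $v\in L^{s_0}(\mathbb{R}^n)$. The notation $f(x)\simeq g(x)$ means there exist constants $c,C>0$ with $cg(x)\leq f(x)\leq Cg(x)$ as $|x|\to\infty$. A positive solution is decaying if $u(x)\simeq|x|^{-\theta_1}$ and $v(x)\simeq|x|^{-\theta_2}$ for some $\theta_1,\theta_2>0$. *)

(* Defs.v *)
From HB Require Import structures.
From mathcomp Require Import all_boot all_order all_algebra.
From mathcomp Require Import all_classical all_reals all_analysis.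
Set Implicit Arguments. Unset Strict Implicit. Unset Printing Implicit Defensive.
Import Order.TTheory GRing.Theory Num.Theory.
Local Open Scope classical_set_scope.
Local Open Scope ring_scope.

Definition enorm {R : realType} {n : nat} (x : 'rV[R]_n) : R :=
  Num.sqrt (\sum_(i < n) x 0 i ^+ 2).

(* Lebesgue integral over R^n of a nonnegative extended-real function,
   as the iterated one-dimensional Lebesgue integral
   (equal to the integral against n-dimensional Lebesgue measure for
   nonnegative measurable integrands, by Tonelli). *)
Fixpoint intRn {R : realType} (n : nat) : ('rV[R]_n -> \bar R) -> \bar R :=
  match n return ('rV[R]_n -> \bar R) -> \bar R with
  | 0 => fun f => f 0
  | n'.+1 => fun f =>
      (\int[@lebesgue_measure R]_t (intRn (fun y : 'rV[R]_n' => f (row_mx t%:M y))))%E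
  end.

Definition boxes {R : realType} (n : nat) : set (set 'rV[R]_n) :=
  [set B | exists a b : 'rV[R]_n, B = [set x : 'rV[R]_n | forall i, a 0 i < x 0 i < b 0 i]].

Definition borel_Rn {R : realType} (n : nat) (A : set 'rV[R]_n) : Prop :=
  <<s (@boxes R n) >> A.

Definition measurable_Rn {R : realType} {n : nat} (f : 'rV[R]_n -> R) : Prop :=
  forall B : set R, measurable B -> borel_Rn (f @^-1` B).

Definition p0 {R : realType} (alpha p q s1 s2 : R) : R :=
  (alpha * (1 + p) - (s2 + s1 * p)) / (p * q - 1).
Definition q0 {R : realType} (alpha p q s1 s2 : R) : R :=
  (alpha * (1 + q) - (s1 + s2 * q)) / (p * q - 1).

Definition in_Lp {R : realType} {n : nat} (r : R) (f : 'rV[R]_n -> R) : Prop :=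
  (intRn (fun x => (`|f x| `^ r)%:E) < +oo)%E.

Definition integrable_sol {R : realType} {n : nat} (alpha p q s1 s2 : R)
    (u v : 'rV[R]_n -> R) : Prop :=
  in_Lp (n%:R / q0 alpha p q s1 s2) u /\ in_Lp (n%:R / p0 alpha p q s1 s2) v.

Definition asym_eq {R : realType} {n : nat} (f g : 'rV[R]_n -> R) : Prop :=
  exists c C R0 : R, 0 < c /\ 0 < C /\
    forall x, R0 < enorm x -> c * g x <= f x /\ f x <= C * g x.

Definition decaying {R : realType} {n : nat} (u v : 'rV[R]_n -> R) : Prop :=
  exists th1 th2 : R, 0 < th1 /\ 0 < th2 /\
    asym_eq u (fun x => enorm x `^ (- th1)) /\ asym_eq v (fun x => enorm x `^ (- th2)).

Definition is_solution {R : realType} {n : nat} (alpha p q s1 s2 : R)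
    (u v : 'rV[R]_n -> R) : Prop :=
  (forall x, (u x)%:E =
     intRn (fun y => (v y `^ q / (enorm (x - y) `^ (n%:R - alpha) * enorm y `^ s1))%:E)) /\
  (forall x, (v x)%:E =
     intRn (fun y => (u y `^ p / (enorm (x - y) `^ (n%:R - alpha) * enorm y `^ s2))%:E)).

(* Main.v *)
Require Import Defs.
From HB Require Import structures.
From mathcomp Require Import all_boot all_order all_algebra.
From mathcomp Require Import all_classical all_reals all_analysis.
From mathcomp Require Import measurable_realfun ring lra.
Import Order.TTheory GRing.Theory Num.Theory.
Local Open Scope ring_scope.

(** Integrating a lower bound [w >= c (1+|x|)^-t] over a cube of side [1+|x|]
    shows that a pointwise lower bound for [u] of order [t] returns, after
    going once around the system, with [t - q0] multiplied by [pq > 1].  If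
    [t < q0] the order eventually becomes negative, contradicting boundedness;
    this is (i).  Moreover [p0 < n - alpha]: otherwise the mass
    [I(r)] of [u^p |y|^-s2] on the ball of radius [r] satisfies
    [I(L r) >= I(r) + C I(r)^(pq)], which outgrows every power of [r], while
    [v >= c r^(alpha-n) I(r)] at distance [r] is bounded.  Hence if [u] decays
    faster than [|x|^-q0], then [v] decays faster than [|x|^-p0] (the usual
    splitting of the potential into the regions near [x], near [0] and far
    away), and both are integrable; this is (ii).  Finally (iii) combines
    the two.

    The lower bounds only use that the integral of a nonnegative function
    is a supremum over simple functions, hence monotone and superadditive even
    for non-measurable functions; in the upper bounds the kernel is
    dominated by finite sums of products of one-variable functions. *)

(** * Lower integrals *)

Section lower_integral.
Local Open Scope classical_set_scope.
Local Open Scope ring_scope.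
Import HBNNSimple.
Context {d} {T : measurableType d} {R : realType}.
Variable mu : {measure set T -> \bar R}.
Local Open Scope ereal_scope.
Implicit Types f g : T -> \bar R.

(** A simple function below [f], multiplied by the indicator of the complement of [N], lies below
    [g] and keeps its integral. Measurability of [f] and [g] never enters. *)
Lemma ge0_le_integral_off (N : set T) f g : measurable N -> mu N = 0 ->
  (forall x, 0 <= f x) -> (forall x, 0 <= g x) ->
  (forall x, ~ N x -> f x <= g x) ->
  \int[mu]_x f x <= \int[mu]_x g x.
Proof.
move=> mN N0 f0 g0 fg; rewrite (ge0_integralTE mu f0) (ge0_integralTE mu g0).
apply: ge_ereal_sup => _ [h /= hf <-].
pose h' := proj_nnsfun h (measurableC mN).
have -> : sintegral mu h = sintegral mu h'.
  rewrite -!integralT_nnsfun; apply: ge0_ae_eq_integral => //=.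
  - exact/measurable_EFinP.
  - exact/measurable_EFinP/(measurable_funPT h').
  - by move=> x _; rewrite lee_fin fun_ge0.
  - by move=> x _; rewrite lee_fin mulr_ge0// fun_ge0.
  exists N; split => // x /= hx; apply: contrapT => Nx; apply: hx => _.
  by rewrite /= mindicE mem_set// mulr1.
apply: ereal_sup_ubound; exists h' => //= x.
rewrite mindicE; have [Nx|Nx] := pselect (N x).
  by rewrite memNset ?mulr0//; exact.
by rewrite mem_set// mulr1; apply: le_trans (hf x) (fg x Nx).
Qed.

Lemma ge0_le_integral_nomeas f g : (forall x, 0 <= f x) ->
  (forall x, f x <= g x) -> \int[mu]_x f x <= \int[mu]_x g x.
Proof.
move=> f0 fg; apply: (@ge0_le_integral_off set0) => // x.
exact: le_trans (f0 x) (fg x).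
Qed.

(** Simple functions below [f] and [g] add up to a simple function below [f + g]. *)
Lemma ge0_integralD_ge f g : (forall x, 0 <= f x) -> (forall x, 0 <= g x) ->
  \int[mu]_x f x + \int[mu]_x g x <= \int[mu]_x (f x + g x).
Proof.
move=> f0 g0.
have sumle (h k : {nnsfun T >-> R}) : (forall x, (h x)%:E <= f x) ->
    (forall x, (k x)%:E <= g x) ->
    sintegral mu h + sintegral mu k <= \int[mu]_x (f x + g x).
  move=> hf kg; rewrite -sintegralD//.
  rewrite ge0_integralTE; last by move=> x; exact: adde_ge0.
  apply: ereal_sup_ubound; exists (add_nnsfun h k) => //= x.
  by rewrite EFinD; apply: leeD.
have fg0 : 0 <= \int[mu]_x (f x + g x) by apply: integral_ge0 => x _; exact: adde_ge0.
(* Once the right-hand side is finite, terms can be moved across the inequality, so that the two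
   suprema are taken one after the other. *)
have [Ifg|] := ltP (\int[mu]_x (f x + g x)) +oo; last first.
  by rewrite leye_eq => /eqP ->; rewrite leey.
have gfin : \int[mu]_x g x \is a fin_num.
  rewrite ge0_fin_numE ?integral_ge0//; apply: le_lt_trans Ifg.
  by apply: ge0_le_integral_nomeas => // x; rewrite leeDr.
rewrite -leeBrDr//.
rewrite [leLHS](ge0_integralTE mu f0); apply: ge_ereal_sup => _ [h /= hf <-].
rewrite leeBrDr//.
have hfin : sintegral mu h \is a fin_num.
  rewrite ge0_fin_numE ?sintegral_ge0//; apply: le_lt_trans Ifg.
  by have := sumle h nnsfun0 hf g0; rewrite sintegral0 adde0.
rewrite addeC -leeBrDr// (ge0_integralTE mu g0).
apply: ge_ereal_sup => _ [k /= kg <-].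
by rewrite leeBrDr// addeC sumle.
Qed.

Lemma ge0_integralZl_ge f (c : R) : (0 <= c)%R -> (forall x, 0 <= f x) ->
  c%:E * \int[mu]_x f x <= \int[mu]_x (c%:E * f x).
Proof.
move=> c0 f0; rewrite (ge0_integralTE mu f0) -ereal_supZl//; last first.
  by apply/set0P; exists (sintegral mu nnsfun0); exists nnsfun0.
rewrite (@ge0_integralTE _ _ _ mu (fun x => c%:E * f x)) => [|x]; last first.
  by rewrite mule_ge0// lee_fin.
apply: ge_ereal_sup => _ [_ [h /= hf <-] <-].
apply: ereal_sup_ubound; exists (scale_nnsfun h c0) => /= [x|].
  by rewrite EFinM lee_wpmul2l// lee_fin.
by rewrite -sintegralrM.
Qed.

(** Some simple [h] below [f] has positive integral. If the weighted integral were zero, [w * h]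
    would vanish almost everywhere, hence so would [h], as [w] is positive off [N]. *)
Lemma integral_weight_gt0 f (w : T -> R) (N : set T) :
  measurable N -> mu N = 0 -> measurable_fun setT w ->
  (forall x, 0 <= w x)%R -> (forall x, ~ N x -> 0 < w x)%R ->
  (forall x, 0 <= f x) ->
  0 < \int[mu]_x f x -> 0 < \int[mu]_x ((w x)%:E * f x).
Proof.
move=> mN N0 mw w0 wgt0 f0; rewrite {1}(ge0_integralTE mu f0).
move=> /ereal_sup_gt[_ [h /= hf <-] h0].
rewrite lt_neqAle eq_sym integral_ge0 ?andbT; last first.
  by move=> x _; rewrite mule_ge0// lee_fin.
apply: contraTN h0 => /eqP int0; rewrite -leNgt.
have wh0 x : 0 <= (w x)%:E * (h x)%:E by rewrite mule_ge0// lee_fin// fun_ge0.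
have mwh : measurable_fun setT (fun x => (w x)%:E * (h x)%:E).
  by apply: emeasurable_funM; exact/measurable_EFinP.
have : \int[mu]_x `|(w x)%:E * (h x)%:E| = 0.
  apply/eqP; rewrite eq_le integral_ge0 ?andbT; last by move=> x _; exact: abse_ge0.
  rewrite -int0; apply: ge0_le_integral_nomeas => x; first exact: abse_ge0.
  by rewrite gee0_abs// lee_wpmul2l// lee_fin.
move/(ae_eq_integral_abs mu measurableT mwh) => [M [mM M0 hM]].
rewrite -integralT_nnsfun.
rewrite -(integral0 mu setT).
apply: (@ge0_le_integral_off (N `|` M)) => //=.
- exact: measurableU.
- by rewrite measureU0.
- by move=> x; rewrite lee_fin fun_ge0.
move=> x NM; rewrite lee_fin leNgt; apply/negP => hx.
apply: NM; have [|Nx] := pselect (N x); first by left.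
right; apply: hM => /=; apply/not_implyP; split => //=.
by apply/eqP; rewrite gt_eqF// -EFinM lte_fin mulr_gt0// wgt0.
Qed.
End lower_integral.

(** * Iterated integrals *)

Section iterated_integral.
Local Open Scope classical_set_scope.
Local Open Scope ring_scope.
Context {R : realType}.
Local Notation mu := (@lebesgue_measure R).

Lemma row_mx_ord0 n (t : R) (y : 'rV[R]_n) :
  (row_mx t%:M y : 'rV[R]_n.+1) 0 ord0 = t.
Proof.
have -> : ord0 = lshift n (ord0 : 'I_1) by exact: val_inj.
by rewrite [LHS](row_mxEl t%:M y 0 (ord0 : 'I_1)) mxE eqxx mulr1n.
Qed.

Lemma row_mx_lift n (t : R) (y : 'rV[R]_n) (i : 'I_n) :
  (row_mx t%:M y : 'rV[R]_n.+1) 0 (lift ord0 i) = y 0 i.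
Proof.
have -> : lift ord0 i = rshift 1 i by exact: val_inj.
exact: (row_mxEr t%:M y 0 i).
Qed.

Local Open Scope ereal_scope.

Lemma intRn_ge0 n (f : 'rV[R]_n -> \bar R) : (forall y, 0 <= f y) -> 0 <= intRn f.
Proof.
elim: n f => [|n IH] f f0 //=.
by apply: integral_ge0 => t _; exact: IH.
Qed.

(** The exceptional set is a union of cylinders over null sets of single coordinates, so it can be
    peeled off one integration at a time. It serves to discard singular points of the kernels. *)
Lemma intRn_le_off n (N : 'I_n -> set R) (f g : 'rV[R]_n -> \bar R) :
  (forall i, measurable (N i)) -> (forall i, mu (N i) = 0) ->
  (forall y, 0 <= f y) -> (forall y, 0 <= g y) ->
  (forall y : 'rV[R]_n, (forall i, ~ N i (y 0%R i)) -> f y <= g y) ->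
  intRn f <= intRn g.
Proof.
elim: n N f g => [|n IH] N f g mN N0 f0 g0 fg /=; first by apply: fg => -[].
apply: (@ge0_le_integral_off _ _ _ mu (N ord0)).
- exact: mN.
- exact: N0.
- by move=> t; exact: intRn_ge0.
- by move=> t; exact: intRn_ge0.
move=> t Nt; apply: (IH (fun i => N (lift ord0 i))) => // y Ny.
apply: fg => i; case: (unliftP ord0 i) => [j ->|->].
  by rewrite row_mx_lift.
by rewrite row_mx_ord0.
Qed.

Lemma intRn_le n (f g : 'rV[R]_n -> \bar R) :
  (forall y, 0 <= f y) -> (forall y, f y <= g y) -> intRn f <= intRn g.
Proof.
move=> f0 fg; apply: (@intRn_le_off _ (fun=> set0)) => // y.
exact: le_trans (f0 y) (fg y).
Qed.

Lemma intRnZ_ge n (f : 'rV[R]_n -> \bar R) (c : R) :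
  (0 <= c)%R -> (forall y, 0 <= f y) ->
  c%:E * intRn f <= intRn (fun y => c%:E * f y).
Proof.
move=> c0; elim: n f => [|n IH] f f0 //=.
apply: (le_trans (@ge0_integralZl_ge _ _ _ mu _ _ c0 _)) => [t|].
  exact: intRn_ge0.
apply: ge0_le_integral_nomeas => t; last exact: IH.
by rewrite mule_ge0 ?lee_fin// intRn_ge0.
Qed.

Lemma intRnD_ge n (f g : 'rV[R]_n -> \bar R) :
  (forall y, 0 <= f y) -> (forall y, 0 <= g y) ->
  intRn f + intRn g <= intRn (fun y => f y + g y).
Proof.
elim: n f g => [|n IH] f g f0 g0 //=.
apply: (le_trans (@ge0_integralD_ge _ _ _ mu _ _ _ _)) => [t|t|]; [exact: intRn_ge0..|].
apply: ge0_le_integral_nomeas => t; last exact: IH.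
by rewrite adde_ge0// intRn_ge0.
Qed.

Lemma intRn_cube_ge n (f : 'rV[R]_n -> \bar R) (a b m : R) :
  (a <= b)%R -> (0 <= m)%R -> (forall y, 0 <= f y) ->
  (forall y : 'rV[R]_n, (forall i, a < y 0 i < b)%R -> m%:E <= f y) ->
  (m * (b - a) ^+ n)%:E <= intRn f.
Proof.
move=> ab m0; elim: n f => [|n IH] f f0 fm /=.
  by rewrite expr0 mulr1; apply: fm => -[].
have ba n' : (0 <= m * (b - a) ^+ n')%R by rewrite mulr_ge0// exprn_ge0// subr_ge0.
apply: (@le_trans _ _ (\int[mu]_(t in `]a, b[) (m * (b - a) ^+ n)%:E)).
  rewrite integral_cst// [X in _ <= _ * X](lebesgue_measure_itv `]a, b[) /= lte_fin.
  case: ltP => [_|ba']; first by rewrite -EFinB -EFinM exprSr mulrA.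
  have -> : a = b by apply/le_anti; rewrite ab.
  by rewrite subrr expr0n/= mulr0 mule0.
rewrite integral_mkcond; apply: ge0_le_integral_nomeas => t.
  by rewrite patchE; case: ifP => // _; rewrite lee_fin.
rewrite patchE; case: ifPn => [|_]; last exact: intRn_ge0.
rewrite inE /= in_itv/= => tab; apply: IH => // y yab.
apply: fm => i; case: (unliftP ord0 i) => [j ->|->].
  by rewrite row_mx_lift.
by rewrite row_mx_ord0.
Qed.

(** This replaces Tonelli in all upper bounds: for a finite sum of products the iterated integral
    factors coordinate by coordinate. *)
Lemma intRn_sum_prod_le n m (c B : 'I_m -> R) (g : 'I_m -> 'I_n -> R -> R) :
  (forall k, 0 <= c k)%R -> (forall k i t, 0 <= g k i t)%R ->
  (forall k i, measurable_fun setT (g k i)) ->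
  (forall k i, \int[mu]_t (g k i t)%:E <= (B k)%:E) ->
  intRn (fun y : 'rV[R]_n => (\sum_k c k * \prod_i g k i (y 0 i))%R%:E) <=
  (\sum_k c k * B k ^+ n)%R%:E.
Proof.
elim: n c g => [|n IH] c g c0 g0 mg gB.
  by rewrite /= lee_fin; apply: ler_sum => k _; rewrite big_ord0 expr0.
have B0 k : (0 <= B k)%R.
  by rewrite -lee_fin (le_trans _ (gB k ord0))// integral_ge0// => t _; rewrite lee_fin.
rewrite /=.
apply: (@le_trans _ _ (\int[mu]_t (\sum_k ((c k * B k ^+ n) * g k ord0 t)%R%:E))).
  apply: ge0_le_integral_nomeas => t.
    apply: intRn_ge0 => y; rewrite lee_fin sumr_ge0// => k _.
    by rewrite mulr_ge0// prodr_ge0.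
  rewrite sumEFin; under eq_bigr do rewrite mulrAC.
  (* With the first coordinate fixed at [t], its factor is absorbed into the coefficients. *)
  apply: le_trans (IH (fun k => c k * g k ord0 t)%R
    (fun k i => g k (lift ord0 i)) _ _ _ _) => //.
  - apply: intRn_le => y.
      rewrite lee_fin sumr_ge0// => k _.
      by rewrite mulr_ge0// prodr_ge0.
    rewrite lee_fin; apply: ler_sum => k _.
    rewrite big_ord_recl row_mx_ord0 mulrA le_eqVlt.
    apply/orP; left; apply/eqP; congr (_ * _)%R.
    by apply: eq_bigr => i _; rewrite row_mx_lift.
  - by move=> k; rewrite mulr_ge0.
rewrite ge0_integral_sum//; last 2 first.
- by move=> k; apply/measurable_EFinP; apply: measurable_funM => //; exact: mg.
- by move=> k t _; rewrite lee_fin !mulr_ge0// exprn_ge0.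
rewrite -sumEFin; apply: lee_sum => k _.
under eq_integral do rewrite EFinM.
rewrite ge0_integralZl_EFin//.
- by rewrite exprSr mulrA [leRHS]EFinM lee_wpmul2l// lee_fin mulr_ge0// exprn_ge0.
- by move=> t _; rewrite lee_fin.
- by apply/measurable_EFinP; exact: mg.
- by rewrite mulr_ge0// exprn_ge0.
Qed.

(** The weight depends on the first coordinate only, so it is a constant for the inner integrals and
    the one-dimensional case applies to the outer one. *)
Lemma intRn_weight_gt0 n (n0 : (0 < n)%N) (f g : 'rV[R]_n -> \bar R)
    (w : R -> R) (N : set R) :
  measurable N -> mu N = 0 -> measurable_fun setT w ->
  (forall t, 0 <= w t)%R -> (forall t, ~ N t -> 0 < w t)%R ->
  (forall y, 0 <= f y) ->
  (forall y : 'rV[R]_n, (w (y 0%R (Ordinal n0)))%:E * f y <= g y) ->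
  0 < intRn f -> 0 < intRn g.
Proof.
case: n n0 f g => // n n0 f g mN N0 mw w0 wgt0 f0 fg /= F0.
have fint0 t : 0 <= intRn (fun y => f (row_mx t%:M y)) by apply: intRn_ge0.
have := @integral_weight_gt0 _ _ _ mu _ w N mN N0 mw w0 wgt0 fint0 F0.
move=> /lt_le_trans; apply.
apply: ge0_le_integral_nomeas => t.
  by rewrite mule_ge0 ?lee_fin// intRn_ge0.
have := @intRnZ_ge n (fun y => f (row_mx t%:M y)) _ (w0 t) (fun y => f0 _).
move=> /le_trans; apply; apply: intRn_le => y; first by rewrite mule_ge0// lee_fin.
apply: le_trans (fg _); rewrite (_ : Ordinal n0 = ord0); last exact: val_inj.
by rewrite row_mx_ord0.
Qed.

End iterated_integral.

(** * One-dimensional power integrals *)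

Section dyadic.
Local Open Scope classical_set_scope.
Local Open Scope ring_scope.
Context {R : realType}.
Local Notation mu := (@lebesgue_measure R).

Lemma integral_dyadic_le (g : R -> R) (a s z b : R) :
  0 < s -> 0 < z -> z `^ (1 - b) < 1 -> (forall t, 0 <= g t) ->
  (forall t, t != a -> g t != 0 -> exists k : nat,
     `|t - a| < s * z ^+ k /\ g t <= (s * z ^+ k / 2) `^ (- b)) ->
  (\int[mu]_t (g t)%:E <=
   (2 * 2 `^ b / (1 - z `^ (1 - b)) * s `^ (1 - b))%:E)%E.
Proof.
move=> s0 z0 zb1 g0 gle.
pose r k := s * z ^+ k; pose c k := (r k / 2) `^ (- b).
have r0 k : 0 < r k by rewrite mulr_gt0// exprn_gt0.
have c0 k : 0 <= c k by exact: powR_ge0.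
pose B k := `]a - r k, a + r k[%classic.
pose h k t := (c k * \1_(B k) t)%:E.
have h0 k t : (0 <= h k t)%E by rewrite lee_fin mulr_ge0.
have mB k : measurable (B k) by exact: measurable_itv.
have mh k : measurable_fun setT (h k).
  by apply/measurable_EFinP; apply: measurable_funM => //; exact: measurable_indic.
have mI k : measurable_fun setT (fun t => (\1_(B k) t)%:E : \bar R).
  by apply/measurable_EFinP; exact: measurable_indic.
apply: (@le_trans _ _ (\int[mu]_t \sum_(k <oo) h k t)%E).
  apply: (@ge0_le_integral_off _ _ _ mu [set a]).
  - exact: measurable_set1.
  - exact: lebesgue_measure_set1.
  - by move=> t; rewrite lee_fin.
  - by move=> t; exact: nneseries_ge0.
  move=> t /eqP ta; have [->|gt0] := eqVneq (g t) 0.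
    exact: nneseries_ge0.
  have [k [tk gk]] := gle t ta gt0.
  apply: (@le_trans _ _ (\sum_(0 <= i < k.+1) h i t)%E); last first.
    exact: nneseries_lim_ge.
  rewrite big_nat_recr//=; apply: (@le_trans _ _ (h k t)).
    rewrite /h lee_fin indicE mem_set ?mulr1//= /B /= in_itv/=.
    by rewrite -ltr_distl.
  by rewrite leeDr// sume_ge0.
rewrite integral_nneseries//.
have zb0 : 0 < z `^ (1 - b) by exact: powR_gt0.
set D := 2 * 2 `^ b * s `^ (1 - b).
have D0 : 0 <= D by rewrite !mulr_ge0// ?powR_ge0.
have hk k : (\int[mu]_t h k t = (geometric D (z `^ (1 - b)) k)%:E)%E.
  rewrite /h; under eq_integral do rewrite EFinM.
  rewrite ge0_integralZl_EFin//; last first.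
    exact: mI.
  have -> : (\int[mu]_t (\1_(B k) t)%:E = (2 * r k)%:E)%E.
    rewrite integral_indic; [|exact: measurableT|exact: mB].
    transitivity (mu (B k)).
      by congr (mu _); exact: setIT.
    rewrite [LHS](lebesgue_measure_itv `]a - r k, a + r k[) /= lte_fin.
    rewrite ifT; last by rewrite ltrBlDr -addrA ltrDl addr_gt0.
    by rewrite -EFinB; congr EFin; ring.
  rewrite -EFinM; congr EFin.
  rewrite /c powRM ?ltW//.
  rewrite -powR_inv1// -powRrM mulN1r opprK.
  have rk1 : r k `^ (- b) * r k = s `^ (1 - b) * z `^ (1 - b) ^+ k.
    rewrite -{2}(powRr1 (ltW (r0 k))) -powRD; last by apply/implyP => _; rewrite gt_eqF.
    rewrite addrC powRM ?ltW// ?exprn_gt0//; congr (_ * _).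
    by rewrite -(powR_mulrn _ (ltW z0)) -(powR_mulrn _ (powR_ge0 _ _)) powRAC.
  rewrite /D /= -[RHS]mulrA -rk1; ring.
under eq_eseriesr do rewrite hk.
apply: lime_le.
  by apply: is_cvg_nneseries => k _ _; rewrite lee_fin geometric_ge0// ltW.
apply: nearW => m; rewrite sumEFin lee_fin.
have := @geometric_le_lim R m D (z `^ (1 - b)) D0 zb0.
rewrite gtr0_norm// => /(_ zb1) /le_trans; apply.
by rewrite /D mulrAC.
Qed.

Lemma exprn_half_lt (e : R) : 0 < e -> exists k : nat, 2^-1 ^+ k < e.
Proof.
move=> e0; exists (Num.truncn e^-1).+1.
rewrite exprVn invf_plt ?posrE ?exprn_gt0//.
apply: lt_trans (truncnS_gt _) _.
by rewrite -natrX ltr_nat ltn_expl.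
Qed.

Lemma integral_powR_near_le (b : R) : 0 < b -> b < 1 ->
  exists2 K, 0 <= K & forall (a r : R), 0 < r ->
  (\int[mu]_t (if `|t - a| < r then `|t - a| `^ (- b) else 0)%:E <=
   (K * r `^ (1 - b))%:E)%E.
Proof.
move=> b0 b1.
have zb1 : (2^-1 : R) `^ (1 - b) < 1.
  rewrite -[ltRHS](congr1 (@^~ (1 - b)) (powR1 R)).
  by apply: gt0_ltr_powR; rewrite ?nnegrE ?subr_gt0 ?invf_lt1// ltr1n.
exists (2 * 2 `^ b / (1 - 2^-1 `^ (1 - b))).
  by rewrite divr_ge0 ?mulr_ge0 ?powR_ge0// subr_ge0 ltW.
move=> a r r0; apply: (@integral_dyadic_le _ a) => //.
- by move=> t; case: ifP => // _; exact: powR_ge0.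
- move=> t ta; case: ifPn => [tr _|]; last by rewrite eqxx.
  have d0 : 0 < `|t - a| by rewrite normr_gt0 subr_eq0.
  have ex : exists k : nat, r * 2^-1 ^+ k / 2 <= `|t - a|.
    have [k hk] := exprn_half_lt _ (divr_gt0 d0 r0).
    exists k; rewrite ltr_pdivlMr// mulrC in hk.
    by rewrite ler_pdivrMr// (le_trans (ltW hk))// ler_peMr// ?ltW// ltr1n.
  (* For the least such [k], either [k = 0] or the inequality fails one step earlier; both give
     [|t - a| < r * 2^-1 ^+ k]. *)
  case: (ex_minnP ex) => k hk kmin; exists k; split.
    case: k hk kmin => [|k] hk kmin; first by rewrite expr0 mulr1.
    rewrite exprSr mulrA ltNge; apply/negP => /kmin.
    by rewrite ltnn.
  rewrite !powRN lef_pV2 ?posrE ?powR_gt0//; last first.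
    by rewrite !mulr_gt0// ?exprn_gt0.
  apply: ge0_ler_powR => //; rewrite ?nnegrE ?ltW//.
  by rewrite !mulr_gt0// ?exprn_gt0.
Qed.

Lemma integral_powR_far_le (b : R) : 1 < b ->
  exists2 K, 0 <= K & forall s : R, 0 < s ->
  (\int[mu]_t ((s + `|t|) `^ (- b))%:E <= (K * s `^ (1 - b))%:E)%E.
Proof.
move=> b1; have b0 : 0 < b by exact: lt_trans b1.
have zb1 : (2 : R) `^ (1 - b) < 1.
  rewrite -opprB powRN invf_lt1 ?powR_gt0// -[ltLHS](congr1 (@^~ (b - 1)) (powR1 R)).
  by apply: gt0_ltr_powR; rewrite ?nnegrE ?subr_gt0// ltr1n.
exists (2 * 2 `^ b / (1 - 2 `^ (1 - b))).
  by rewrite divr_ge0 ?mulr_ge0 ?powR_ge0// subr_ge0 ltW.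
move=> s s0; apply: (@integral_dyadic_le _ 0) => //.
- by move=> t; exact: powR_ge0.
- move=> t _ _; rewrite subr0.
  have ex : exists k : nat, `|t| < s * 2 ^+ k.
    exists (Num.truncn (`|t| / s)).+1.
    rewrite -ltr_pdivrMl// mulrC; apply: lt_trans (truncnS_gt _) _.
    by rewrite -natrX ltr_nat ltn_expl.
  (* Minimality of [k] gives [s * 2 ^+ k / 2 <= s + |t|]; the summand [s] covers [k = 0]. *)
  case: (ex_minnP ex) => k hk kmin; exists k; split => //.
  rewrite !powRN lef_pV2 ?posrE ?powR_gt0//; last 2 first.
    by rewrite ltr_wpDr.
    by rewrite !mulr_gt0// ?exprn_gt0.
  apply: ge0_ler_powR; rewrite ?nnegrE ?ltW//.
  - by rewrite !mulr_gt0// ?exprn_gt0.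
  - by rewrite ltr_wpDr.
  case: k hk kmin => [|k] hk kmin.
    by rewrite expr0 mulr1; have := normr_ge0 t; lra.
  have : s * 2 ^+ k <= `|t| by rewrite leNgt; apply/negP => /kmin; rewrite ltnn.
  by rewrite exprSr mulrA mulfK// => skt; lra.
Qed.
End dyadic.

(** * The Euclidean norm *)

Lemma le_powRl (R : realType) (a b t : R) : 0 <= t -> 0 <= a -> a <= b ->
  a `^ t <= b `^ t.
Proof.
by move=> t0 a0 ab; apply: ge0_ler_powR; rewrite ?nnegrE// (le_trans a0).
Qed.

Lemma ge_powRNl (R : realType) (a b t : R) : 0 <= t -> 0 < a -> a <= b ->
  b `^ (- t) <= a `^ (- t).
Proof.
move=> t0 a0 ab; have b0 := lt_le_trans a0 ab.
by rewrite !powRN lef_pV2 ?posrE ?powR_gt0// le_powRl// ltW.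
Qed.

Lemma powRDgt0 (R : realType) (a s t : R) : 0 < a -> a `^ (s + t) = a `^ s * a `^ t.
Proof. by move=> a0; rewrite powRD//; apply/implyP => _; rewrite gt_eqF. Qed.

Section euclidean_norm.
Context {R : realType} {n : nat}.
Implicit Types x y : 'rV[R]_n.

Lemma enorm_ge0 x : 0 <= enorm x.
Proof. exact: sqrtr_ge0. Qed.

Lemma sqr_enorm x : enorm x ^+ 2 = \sum_(i < n) x 0 i ^+ 2.
Proof. by rewrite sqr_sqrtr// sumr_ge0// => i _; exact: sqr_ge0. Qed.

Lemma enormN x : enorm (- x) = enorm x.
Proof. by rewrite /enorm; congr Num.sqrt; apply: eq_bigr => i _; rewrite mxE sqrrN. Qed.

Lemma enormBC x y : enorm (x - y) = enorm (y - x).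
Proof. by rewrite -opprB enormN. Qed.

Lemma normr_le_enorm x i : `|x 0 i| <= enorm x.
Proof.
rewrite -(@ler_pXn2r _ 2)// ?nnegrE ?enorm_ge0// sqr_enorm real_normK ?num_real//.
by rewrite (bigD1 i)//= lerDl sumr_ge0// => j _; exact: sqr_ge0.
Qed.

Lemma enorm_gt0 x i : x 0 i != 0 -> 0 < enorm x.
Proof.
by move=> xi0; apply: lt_le_trans (normr_le_enorm x i); rewrite normr_gt0.
Qed.

Lemma enorm_le_coord x (m : R) : (forall i, `|x 0 i| <= m) -> enorm x <= n%:R * m.
Proof.
case: (posnP n) => [n0 _|n0 xm].
  rewrite /enorm big1 ?sqrtr0; first by rewrite n0 mul0r.
  by move=> i _; have := ltn_ord i; rewrite {2}n0.
have m0 : 0 <= m by exact: le_trans (normr_ge0 _) (xm (Ordinal n0)).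
rewrite -(@ler_pXn2r _ 2)// ?nnegrE ?enorm_ge0// ?mulr_ge0// sqr_enorm.
apply: (@le_trans _ _ (\sum_(i < n) m ^+ 2)).
  apply: ler_sum => i _.
  by rewrite -real_normK ?num_real// ler_pXn2r// nnegrE.
rewrite sumr_const card_ord -[leLHS]mulr_natl exprMn ler_wpM2r ?sqr_ge0//.
by rewrite expr2 ler_peMl// ler1n.
Qed.

Lemma dot_le_enorm x y : \sum_(i < n) x 0 i * y 0 i <= enorm x * enorm y.
Proof.
have [x0|x0] := eqVneq (enorm x) 0.
  rewrite x0 mul0r big1// => i _; apply/eqP; rewrite mulf_eq0; apply/orP; left.
  by rewrite -normr_le0 -x0 normr_le_enorm.
have [y0|y0] := eqVneq (enorm y) 0.
  rewrite y0 mulr0 big1// => i _; apply/eqP; rewrite mulf_eq0; apply/orP; right.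
  by rewrite -normr_le0 -y0 normr_le_enorm.
have A0 : 0 < enorm x by rewrite lt0r x0 enorm_ge0.
have B0 : 0 < enorm y by rewrite lt0r y0 enorm_ge0.
set A := enorm x in A0 x0 *; set B := enorm y in B0 y0 *.
(* Young's inequality, weighted so that the two sums of squares contribute [A * B / 2] each. *)
apply: (@le_trans _ _ (\sum_(i < n) (B / (2 * A) * x 0 i ^+ 2 + A / (2 * B) * y 0 i ^+ 2))).
  apply: ler_sum => i _; rewrite -subr_ge0.
  have -> : B / (2 * A) * x 0 i ^+ 2 + A / (2 * B) * y 0 i ^+ 2 - x 0 i * y 0 i =
      (B * x 0 i - A * y 0 i) ^+ 2 / (2 * A * B).
    by field; rewrite x0 y0.
  by rewrite divr_ge0 ?sqr_ge0// !mulr_ge0// ltW.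
rewrite big_split/= -!mulr_sumr -!sqr_enorm -/A -/B.
by rewrite le_eqVlt; apply/orP; left; apply/eqP; field; rewrite x0 y0.
Qed.

Lemma enormB_le x y : enorm (x - y) <= enorm x + enorm y.
Proof.
rewrite -(@ler_pXn2r _ 2)// ?nnegrE ?enorm_ge0// ?addr_ge0 ?enorm_ge0//.
rewrite sqr_enorm sqrrD !sqr_enorm.
have -> : \sum_(i < n) (x - y) 0 i ^+ 2 = \sum_(i < n) x 0 i ^+ 2
    + 2 * (\sum_(i < n) x 0 i * (- y) 0 i) + \sum_(i < n) y 0 i ^+ 2.
  rewrite mulr_sumr -!big_split/=; apply: eq_bigr => i _.
  by rewrite !mxE; ring.
rewrite lerD2r lerD2l -[leRHS]mulr_natl ler_pM2l//.
by apply: le_trans (dot_le_enorm x (- y)) _; rewrite enormN.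
Qed.

Lemma enormB_ge x y : enorm x - enorm y <= enorm (x - y).
Proof.
rewrite lerBlDr.
by have := enormB_le (x - y) (- y); rewrite opprK subrK enormN.
Qed.

(* The powers are negative, so each factor dominates the whole norm. *)
Lemma powR_prod_le (m : R) (f : 'I_n -> R) (b : R) : (0 < n)%N -> 0 < b -> 0 < m ->
  (forall i, 0 < f i <= m) -> m `^ (- b) <= \prod_(i < n) f i `^ (- (b / n%:R)).
Proof.
move=> n0 b0 m0 fm.
have nR : (n%:R : R) != 0 by rewrite pnatr_eq0 -lt0n.
have -> : m `^ (- b) = \prod_(i < n) m `^ (- (b / n%:R)).
  rewrite prodr_const card_ord -powR_mulrn ?powR_ge0// -powRrM.
  by rewrite mulNr divfK.
apply: ler_prod => i _; rewrite powR_ge0/= !powRN.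
have /andP[fi0 fim] := fm i.
by rewrite -?powRN ge_powRNl// divr_ge0// ltW.
Qed.
End euclidean_norm.

(** * Lower bounds for Riesz potentials *)

Section lower_bounds.
Local Open Scope classical_set_scope.
Local Open Scope ring_scope.
Context {R : realType} {n : nat}.
Implicit Types (w f : 'rV[R]_n -> R) (x y : 'rV[R]_n).

Definition riesz_eq (alpha s p : R) w f : Prop :=
  forall x, (f x)%:E = intRn (fun y =>
    (w y `^ p / (enorm (x - y) `^ (n%:R - alpha) * enorm y `^ s))%:E).

(** A cube of volume [r ^ n] at distance comparable to [r] from the origin, and disjoint from the
    ball of radius [r]. *)
Definition in_cube (r : R) y := forall i, r < y 0 i < 2 * r.

(** Chosen above [2 * n], so that the cube at scale [r] lies inside the open ball of radius
    [L * r]. *)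
Local Notation L := (2 * n%:R + 1 : R).

Lemma in_cube_enorm (r : R) y : (0 < n)%N -> 0 < r -> in_cube r y ->
  r < enorm y <= 2 * n%:R * r.
Proof.
move=> n0 r0 yr; apply/andP; split.
  have /andP[+ _] := yr (Ordinal n0) => /lt_le_trans; apply.
  by apply: le_trans (ler_norm _) _; exact: normr_le_enorm.
have -> : 2 * n%:R * r = n%:R * (2 * r) by ring.
apply: enorm_le_coord => i; have /andP[ry yr2] := yr i.
by rewrite ger0_norm ltW// (lt_trans r0).
Qed.

Lemma intRn_in_cube_ge (F : 'rV[R]_n -> \bar R) (r m : R) :
  0 < r -> 0 <= m -> (forall y, (0 <= F y)%E) ->
  (forall y, in_cube r y -> (m%:E <= F y)%E) ->
  ((m * r `^ n%:R)%:E <= intRn F)%E.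
Proof.
move=> r0 m0 F0 mF; rewrite powR_mulrn ?(ltW r0)//.
have -> : r ^+ n = (2 * r - r) ^+ n by congr (_ ^+ _); ring.
by apply: (@intRn_cube_ge _ _ _ r (2 * r)) => //; lra.
Qed.

Lemma powR_comparable (r z l t : R) : 0 < r -> 1 <= l -> r <= z <= l * r ->
  l `^ (- `|t|) * r `^ t <= z `^ t.
Proof.
move=> r0 l1 /andP[rz zl].
have l0 : 0 < l by exact: lt_le_trans l1.
have z0 : 0 < z by exact: lt_le_trans rz.
have [t0|t0] := leP 0 t.
  apply: (@le_trans _ _ (r `^ t)); last by rewrite le_powRl// ltW.
  rewrite -[leRHS]mul1r ler_wpM2r ?powR_ge0// -[leRHS](powRr0 l).
  by rewrite ler_powR// oppr_le0.
rewrite ltr0_norm// opprK -powRM ?(ltW l0) ?(ltW r0)// -[t]opprK.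
by rewrite ge_powRNl// oppr_ge0 ltW.
Qed.

Variables alpha s p : R.
Hypotheses (n_gt0 : (0 < n)%N) (alpha_lt : alpha < n%:R) (s_ge0 : 0 <= s) (p_gt0 : 0 < p).

Let L1 : 1 <= L.
Proof. by rewrite lerDr mulr_ge0. Qed.
Let L0 : 0 < L.
Proof. exact: lt_le_trans L1. Qed.
Let na0 : 0 < n%:R - alpha.
Proof. by rewrite subr_gt0. Qed.

Lemma kernel_ge0 w x y :
  0 <= w y `^ p / (enorm (x - y) `^ (n%:R - alpha) * enorm y `^ s).
Proof. by rewrite divr_ge0 ?mulr_ge0 ?powR_ge0. Qed.

Lemma riesz_cube_ge : exists2 c, 0 < c & forall w f (m r : R) x,
  riesz_eq alpha s p w f -> 0 < r -> 0 <= m -> enorm x <= r ->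
  (forall y, in_cube r y -> m <= w y `^ p) -> c * m * r `^ (alpha - s) <= f x.
Proof.
pose l := L + 1.
have l0 : 0 < l by rewrite addr_gt0.
exists ((l `^ (n%:R - alpha) * l `^ s)^-1).
  by rewrite invr_gt0 mulr_gt0// powR_gt0.
move=> w f m r x wf r0 m0 xr mw.
rewrite -lee_fin wf.
pose K := (l * r) `^ (n%:R - alpha) * (l * r) `^ s.
have lr0 : 0 < l * r by rewrite mulr_gt0.
have K0 : 0 < K by rewrite mulr_gt0// powR_gt0.
have -> : (l `^ (n%:R - alpha) * l `^ s)^-1 * m * r `^ (alpha - s) =
    m / K * r `^ n%:R.
  rewrite /K !powRM ?ltW//.
  have -> : r `^ n%:R = r `^ (alpha - s) * (r `^ (n%:R - alpha) * r `^ s).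
    by rewrite -!powRDgt0//; congr (_ `^ _); ring.
  by field; rewrite !gt_eqF ?powR_gt0.
apply: intRn_in_cube_ge => //; first by rewrite divr_ge0// ltW.
  by move=> y; rewrite lee_fin kernel_ge0.
move=> y yr; rewrite lee_fin; have /andP[ry yL] := in_cube_enorm _ _ n_gt0 r0 yr.
have y0 : 0 < enorm y by exact: lt_trans ry.
have xy0 : 0 < enorm (x - y).
  have : 0 < enorm y - enorm x by rewrite subr_gt0 (le_lt_trans xr).
  by move=> /lt_le_trans; apply; rewrite enormBC enormB_ge.
apply: ler_pM => //; [by rewrite invr_ge0 ltW|exact: mw|].
rewrite lef_pV2 ?posrE ?mulr_gt0 ?powR_gt0//.
apply: ler_pM; rewrite ?powR_ge0//; apply: le_powRl; rewrite ?enorm_ge0 ?(ltW na0)//.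
  apply: le_trans (enormB_le x y) _; rewrite /l; lra.
rewrite /l; lra.
Qed.

Lemma riesz_decay_ge w f (c t : R) : riesz_eq alpha s p w f -> 0 < c ->
  (forall x, c * (1 + enorm x) `^ (- t) <= w x) ->
  exists2 c', 0 < c' & forall x, c' * (1 + enorm x) `^ (- (p * t - alpha + s)) <= f x.
Proof.
move=> wf c0 cw; have [k k0 kP] := riesz_cube_ge.
pose b := c * L `^ (- `|- t|).
have b0 : 0 < b by rewrite mulr_gt0// powR_gt0.
exists (k * b `^ p); first by rewrite mulr_gt0// powR_gt0.
move=> x; set r := 1 + enorm x.
have r1 : 1 <= r by rewrite lerDl enorm_ge0.
have r0 : 0 < r by exact: lt_le_trans r1.
have -> : k * b `^ p * r `^ (- (p * t - alpha + s)) =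
    k * (b * r `^ (- t)) `^ p * r `^ (alpha - s).
  rewrite powRM ?powR_ge0 ?ltW// -powRrM -!mulrA; congr (_ * (_ * _)).
  by rewrite -powRDgt0//; congr (_ `^ _); ring.
apply: (kP w) => //; first exact: powR_ge0.
  by rewrite lerDr.
move=> y yr; have /andP[ry yL] := in_cube_enorm _ _ n_gt0 r0 yr.
have wy : b * r `^ (- t) <= w y.
  apply: le_trans (cw y); rewrite /b -mulrA ler_wpM2l ?(ltW c0)//.
  by apply: powR_comparable => //; apply/andP; split; lra.
have br0 : 0 <= b * r `^ (- t) by rewrite mulr_ge0 ?powR_ge0// ltW.
by rewrite le_powRl// ltW.
Qed.

(** Since [|x - y| <= (1 + |x|) * (1 + |y|)], the dependence on [x] splits off the kernel; what
    remains is the integral of [G], positive and finite by comparison with [f 0]. *)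
Lemma riesz_ge w f : riesz_eq alpha s p w f -> 0 < f 0 ->
  exists2 c, 0 < c & forall x, c * (1 + enorm x) `^ (- (n%:R - alpha)) <= f x.
Proof.
move=> wf f00; pose G y :=
  (w y `^ p / ((1 + enorm y) `^ (n%:R - alpha) * enorm y `^ s))%:E.
have G0 y : (0 <= G y)%E by rewrite lee_fin divr_ge0 ?mulr_ge0 ?powR_ge0.
have x1 x : 0 < 1 + enorm x by rewrite ltr_wpDr// enorm_ge0.
have fG x : (((1 + enorm x) `^ (- (n%:R - alpha)))%:E * intRn G <= (f x)%:E)%E.
  rewrite wf; apply: le_trans (@intRnZ_ge _ _ _ _ (powR_ge0 _ _) G0) _.
  (* The point [y = x] must be discarded: the inverse of the kernel is 0 there by convention. *)
  apply: (@intRn_le_off _ _ (fun i => [set x 0 i])).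
  - by move=> i; exact: measurable_set1.
  - by move=> i; exact: lebesgue_measure_set1.
  - by move=> y; rewrite mule_ge0// lee_fin powR_ge0.
  - by move=> y; rewrite lee_fin kernel_ge0.
  move=> y yx; have xy0 : 0 < enorm (x - y).
    apply: (@enorm_gt0 _ _ _ (Ordinal n_gt0)); rewrite !mxE subr_eq0 eq_sym.
    by apply/eqP; exact: yx.
  rewrite lee_fin powRN mulrCA ler_wpM2l ?powR_ge0// !invfM mulrA.
  rewrite ler_wpM2r ?invr_ge0 ?powR_ge0// -invfM -powRM ?(ltW (x1 _))//.
  rewrite lef_pV2 ?posrE ?powR_gt0 ?mulr_gt0// le_powRl ?(ltW na0) ?enorm_ge0//.
  apply: le_trans (enormB_le x y) _.
  have := enorm_ge0 x; have := enorm_ge0 y; nra.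
have intG0 : (0 < intRn G)%E.
  have : (0 < (f 0)%:E)%E by rewrite lte_fin.
  pose wt (t : R) := (`|t| / (1 + `|t|)) `^ (n%:R - alpha).
  have t1 (t : R) : 0 < 1 + `|t| by rewrite ltr_wpDr.
  rewrite wf; apply: (@intRn_weight_gt0 _ _ n_gt0 _ _ wt [set 0]).
  - exact: measurable_set1.
  - exact: lebesgue_measure_set1.
  - apply: (@measurableT_comp _ _ _ _ _ _ (@powR R ^~ (n%:R - alpha))) => //.
    apply: continuous_measurable_fun => t; apply: cvgM.
      exact: norm_continuous.
    apply: cvgV; first by rewrite gt_eqF.
    by apply: cvgD; [exact: cvg_cst|exact: norm_continuous].
  - by move=> t; exact: powR_ge0.
  - by move=> t /eqP t0; rewrite powR_gt0// divr_gt0// normr_gt0.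
  - by move=> y; rewrite lee_fin kernel_ge0.
  move=> y; rewrite -EFinM lee_fin sub0r enormN.
  have [y0|y0] := eqVneq (enorm y) 0.
    by rewrite y0 powR0 ?gt_eqF// mul0r invr0 !mulr0 divr_ge0 ?mulr_ge0 ?powR_ge0.
  have {}y0 : 0 < enorm y by rewrite lt0r y0 enorm_ge0.
  rewrite mulrCA ler_wpM2l ?powR_ge0// !invfM mulrA.
  rewrite ler_wpM2r ?invr_ge0 ?powR_ge0// ler_pdivrMr ?powR_gt0//.
  have -> : ((1 + enorm y) `^ (n%:R - alpha))^-1 * enorm y `^ (n%:R - alpha) =
      (enorm y / (1 + enorm y)) `^ (n%:R - alpha).
    rewrite powRM ?enorm_ge0 ?invr_ge0 ?(ltW (x1 y))// mulrC; congr (_ * _).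
    by rewrite -[in RHS]powR_inv1 ?(ltW (x1 y))// powRAC powR_inv1 ?powR_ge0.
  apply: le_powRl; rewrite ?(ltW na0) ?divr_ge0 ?(ltW (t1 _))//.
  rewrite ler_pdivrMr// mulrAC ler_pdivlMr//.
  have := normr_le_enorm y (Ordinal n_gt0); nra.
have Gfin : intRn G \is a fin_num.
  have := fG 0; rewrite ge0_fin_numE ?intRn_ge0//; case: (intRn G) => [r _|h|//].
    by rewrite ltry.
  by move: h; rewrite gt0_muley ?leye_eq// lte_fin powR_gt0.
exists (fine (intRn G)).
  by rewrite fine_gt0// intG0/= -ge0_fin_numE ?intRn_ge0.
move=> x; rewrite mulrC -lee_fin EFinM fineK//.
Qed.

Lemma bounded_decay_exponent_ge0 f (M c t : R) : 0 < c ->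
  (forall x, f x <= M) -> (forall x, c * (1 + enorm x) `^ (- t) <= f x) -> 0 <= t.
Proof.
move=> c0 fM cf; rewrite leNgt; apply/negP => t0.
have nt0 : 0 < - t by rewrite oppr_gt0.
have M0 : 0 < M.
  apply: lt_le_trans (fM 0); apply: lt_le_trans (cf 0).
  by rewrite mulr_gt0// powR_gt0// ltr_wpDr// enorm_ge0.
pose r := (2 * M / c) `^ (- t)^-1.
pose x : 'rV[R]_n := const_mx r.
have rx : r <= 1 + enorm x.
  have := normr_le_enorm x (Ordinal n_gt0); rewrite mxE ger0_norm ?powR_ge0// => rx.
  by rewrite ler_wpDl.
have : 2 * M <= M.
  apply: le_trans (fM x); apply: le_trans (cf x).
  rewrite -ler_pdivrMl// mulrC.
  have -> : 2 * M / c = r `^ (- t).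
    rewrite /r -powRrM mulVf ?gt_eqF// powRr1 ?divr_ge0// ?ltW// mulr_gt0//.
  by apply: le_powRl => //; [exact: ltW|exact: powR_ge0].
by lra.
Qed.
End lower_bounds.

(** * Upper bounds for Riesz potentials *)

Section upper_bounds.
Local Open Scope classical_set_scope.
Local Open Scope ring_scope.
Context {R : realType} {n : nat}.
Implicit Types (w f : 'rV[R]_n -> R) (x y : 'rV[R]_n).
Hypothesis n_gt0 : (0 < n)%N.

Lemma measurable_near_power (a r b : R) : measurable_fun setT
  (fun t : R => if `|t - a| < r then `|t - a| `^ (- b) else 0).
Proof.
have m1 : measurable_fun setT (fun t : R => `|t - a|).
  by apply: measurableT_comp => //; exact: measurable_funB.
apply: measurable_fun_ifT => //.
  by apply: measurable_fun_ltr.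
exact: (@measurableT_comp _ _ _ _ _ _ (@powR R ^~ (- b))).
Qed.

Lemma measurable_far_power (s b : R) : measurable_fun setT
  (fun t : R => (s + `|t|) `^ (- b)).
Proof.
apply: (@measurableT_comp _ _ _ _ _ _ (@powR R ^~ (- b))) => //.
by apply: measurable_funD => //; exact: measurableT_comp.
Qed.

(** The power [n / e] of [w] decays with order [n * t / e]; shared among the coordinates this leaves
    each the exponent [t / e > 1], integrable on the line. *)
Lemma in_Lp_decay w (C t e : R) : (forall x, 0 <= w x) ->
  (forall x, w x <= C * (1 + enorm x) `^ (- t)) -> 0 < e -> e < t ->
  in_Lp (n%:R / e) w.
Proof.
move=> w0 wC e0 et; have t0 : 0 < t by exact: lt_trans et.
have C0 : 0 <= C.
  have := le_trans (w0 0) (wC 0); rewrite pmulr_lge0// powR_gt0//.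
  by rewrite ltr_wpDr// enorm_ge0.
have nR0 : 0 < n%:R :> R by rewrite ltr0n.
have te1 : 1 < t / e by rewrite ltr_pdivlMr// mul1r.
have [K K0 KP] := integral_powR_far_le _ te1.
pose a := C `^ (n%:R / e).
apply: (@le_lt_trans _ _ (\sum_(k < 1) a * (K * 1 `^ (1 - t / e)) ^+ n)%:E); last exact: ltry.
apply: le_trans; last first.
  apply: (@intRn_sum_prod_le _ _ _ _ _ (fun _ _ t' => (1 + `|t'|) `^ (- (t / e)))).
  - by move=> _; exact: powR_ge0.
  - by move=> _ _ t'; exact: powR_ge0.
  - by move=> _ _; exact: measurable_far_power.
  - by move=> _ _; exact: KP.
apply: intRn_le => y; first by rewrite lee_fin powR_ge0.
rewrite lee_fin big_ord_recl big_ord0 addr0 ger0_norm//.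
have y1 : 0 < 1 + enorm y by rewrite ltr_wpDr// enorm_ge0.
have ne0 : 0 <= n%:R / e by rewrite divr_ge0// ltW.
apply: (@le_trans _ _ ((C * (1 + enorm y) `^ (- t)) `^ (n%:R / e))).
  exact: le_powRl.
rewrite powRM ?powR_ge0// ler_wpM2l ?powR_ge0// -powRrM.
have -> : - t * (n%:R / e) = - (t / e * n%:R) by ring.
have -> : \prod_(i < n) (1 + `|y 0 i|) `^ (- (t / e)) =
    \prod_(i < n) (1 + `|y 0 i|) `^ (- (t / e * n%:R / n%:R)).
  by rewrite mulfK// gt_eqF.
apply: powR_prod_le => //; first by rewrite mulr_gt0// (lt_trans _ te1).
by move=> i; rewrite ltr_wpDr//= lerD2l normr_le_enorm.
Qed.

Variables alpha s p : R.
Hypotheses (alpha_gt0 : 0 < alpha) (alpha_lt : alpha < n%:R) (p_gt0 : 0 < p).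

Lemma riesz_decay_le w f (C t : R) : riesz_eq alpha s p w f ->
  (forall x, 0 <= w x) -> (forall x, w x <= C * (1 + enorm x) `^ (- t)) ->
  0 <= t -> alpha < p * t + s -> p * t + s < n%:R ->
  exists C', forall x, 0 < enorm x -> f x <= C' * enorm x `^ (- (p * t + s - alpha)).
Proof.
move=> wf w0 wC t0; set A := p * t + s => aA An.
have C0 : 0 <= C.
  have := le_trans (w0 0) (wC 0); rewrite pmulr_lge0// powR_gt0//.
  by rewrite ltr_wpDr// enorm_ge0.
pose N : R := n%:R; have N0 : 0 < N by rewrite ltr0n.
have Nn0 : N != 0 by rewrite gt_eqF.
have A0 : 0 < A by exact: lt_trans aA.
have na0 : 0 < N - alpha by rewrite subr_gt0.
pose E := A + (N - alpha).
have E0 : 0 < E by rewrite addr_gt0.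
have [K1 K10 K1P] : exists2 K, 0 <= K & forall (a r : R), 0 < r ->
    (\int[@lebesgue_measure R]_t
       (if `|t - a| < r then `|t - a| `^ (- ((N - alpha) / N)) else 0)%:E <=
     (K * r `^ (1 - (N - alpha) / N))%:E)%E.
  apply: integral_powR_near_le; first by rewrite divr_gt0.
  by rewrite ltr_pdivrMr// mul1r ltrBlDr ltrDl.
have [K2 K20 K2P] : exists2 K, 0 <= K & forall (a r : R), 0 < r ->
    (\int[@lebesgue_measure R]_t (if `|t - a| < r then `|t - a| `^ (- (A / N)) else 0)%:E <=
     (K * r `^ (1 - A / N))%:E)%E.
  apply: integral_powR_near_le; first by rewrite divr_gt0.
  by rewrite ltr_pdivrMr// mul1r.
have [K3 K30 K3P] : exists2 K, 0 <= K & forall r : R, 0 < r ->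
    (\int[@lebesgue_measure R]_t ((r + `|t|) `^ (- (E / N)))%:E <=
     (K * r `^ (1 - E / N))%:E)%E.
  by apply: integral_powR_far_le; rewrite ltr_pdivlMr// mul1r /E; lra.
exists (C `^ p * (2^-1 `^ (- A) * K1 ^+ n * 2^-1 `^ alpha +
  2^-1 `^ (- (N - alpha)) * K2 ^+ n * 2 `^ (N - A) + 4^-1 `^ (- E) * K3 ^+ n)).
move=> x x0; set r := enorm x in x0 *.
have r20 : 0 < r / 2 by rewrite divr_gt0.
have r21 : 0 < 2 * r by rewrite mulr_gt0.
pose c1 := C `^ p * (r / 2) `^ (- A).
pose c2 := C `^ p * (r / 2) `^ (- (N - alpha)).
pose c3 := C `^ p * 4^-1 `^ (- E).
pose g1 (i : 'I_n) (t' : R) :=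
  if `|t' - x 0 i| < r / 2 then `|t' - x 0 i| `^ (- ((N - alpha) / N)) else 0.
pose g2 (i : 'I_n) (t' : R) := if `|t' - 0| < 2 * r then `|t' - 0| `^ (- (A / N)) else 0.
pose g3 (i : 'I_n) (t' : R) := (r + `|t'|) `^ (- (E / N)).
pose B1 := K1 * (r / 2) `^ (1 - (N - alpha) / N).
pose B2 := K2 * (2 * r) `^ (1 - A / N).
pose B3 := K3 * r `^ (1 - E / N).
pose c (k : 'I_3) := nth 0 [:: c1; c2; c3] k.
pose g (k : 'I_3) := nth g1 [:: g1; g2; g3] k.
pose B (k : 'I_3) := nth 0 [:: B1; B2; B3] k.
have c10 : 0 <= c1 by rewrite mulr_ge0 ?powR_ge0.
have c20 : 0 <= c2 by rewrite mulr_ge0 ?powR_ge0.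
have c30 : 0 <= c3 by rewrite mulr_ge0 ?powR_ge0.
have g10 i t' : 0 <= g1 i t' by rewrite /g1; case: ifP => // _; exact: powR_ge0.
have g20 i t' : 0 <= g2 i t' by rewrite /g2; case: ifP => // _; exact: powR_ge0.
have g30 i t' : 0 <= g3 i t' by exact: powR_ge0.
have -> : C `^ p * (2^-1 `^ (- A) * K1 ^+ n * 2^-1 `^ alpha +
    2^-1 `^ (- (N - alpha)) * K2 ^+ n * 2 `^ (N - A) + 4^-1 `^ (- E) * K3 ^+ n) *
    r `^ (- (A - alpha)) = \sum_k c k * B k ^+ n.
  rewrite !big_ord_recl big_ord0 /c /B /= addr0 addrA.
  have pw (a e : R) : (a `^ e) ^+ n = a `^ (e * N).
    by rewrite -powR_mulrn ?powR_ge0// -powRrM.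
  rewrite /c1 /c2 /c3 /B1 /B2 /B3 !exprMn !pw.
  rewrite !mulrBl !divfK// !mul1r (_ : N - (N - alpha) = alpha); last by ring.
  have r0 := ltW x0.
  rewrite !(powRM _ r0)// !(powRM _ _ r0)//.
  set T := r `^ (- (A - alpha)).
  have h1 : r `^ (- A) * r `^ alpha = T.
    by rewrite -powRDgt0//; congr (_ `^ _); ring.
  have h2 : r `^ (- (N - alpha)) * r `^ (N - A) = T.
    by rewrite -powRDgt0//; congr (_ `^ _); ring.
  have h3 : r `^ (N - E) = T by congr (_ `^ _); rewrite /E; ring.
  transitivity (C `^ p * (2^-1 `^ (- A) * K1 ^+ n * 2^-1 `^ alpha * (r `^ (- A) * r `^ alpha) +
    2^-1 `^ (- (N - alpha)) * K2 ^+ n * 2 `^ (N - A) * (r `^ (- (N - alpha)) * r `^ (N - A)) +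
    4^-1 `^ (- E) * K3 ^+ n * r `^ (N - E))).
    by rewrite h1 h2 h3; ring.
  ring.
rewrite -lee_fin wf.
have prod_ge0 (h : 'I_n -> R -> R) (y : 'rV[R]_n) : (forall i t', 0 <= h i t') ->
    0 <= \prod_i h i (y 0 i) by move=> h0; rewrite prodr_ge0.
apply: le_trans; last first.
  apply: (@intRn_sum_prod_le _ _ _ c B g).
  - by move=> -[[|[|[|//]]] ?].
  - by move=> -[[|[|[|//]]] ?] i t'.
  - by move=> -[[|[|[|//]]] ?] i; [exact: measurable_near_power..|exact: measurable_far_power].
  - by move=> -[[|[|[|//]]] ?] i; [exact: K1P|exact: K2P|exact: K3P].
(* On these hyperplanes a negative power of a zero coordinate is 0 by convention, and the products
   would not dominate. *)
apply: (@intRn_le_off _ _ (fun i => [set 0] `|` [set x 0 i])).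
- by move=> i; exact: measurableU.
- by move=> i; rewrite null_set_setU//; exact: lebesgue_measure_set1.
- by move=> y; rewrite lee_fin divr_ge0 ?mulr_ge0 ?powR_ge0.
- by move=> y; rewrite lee_fin sumr_ge0// => -[[|[|[|//]]] ?] _; rewrite mulr_ge0// prod_ge0.
move=> y yx; rewrite lee_fin !big_ord_recl big_ord0 /c /g /= addr0.
have yi0 i : 0 < `|y 0 i| by rewrite normr_gt0; apply/eqP => h; apply: (yx i); left.
have yxi0 i : 0 < `|y 0 i - x 0 i|.
  by rewrite normr_gt0 subr_eq0; apply/eqP => h; apply: (yx i); right.
have y0 : 0 < enorm y by apply: lt_le_trans (normr_le_enorm y (Ordinal n_gt0)).
have yxle i : `|y 0 i - x 0 i| <= enorm (x - y).
  by rewrite enormBC; have := normr_le_enorm (y - x) i; rewrite !mxE.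
have xy0 : 0 < enorm (x - y) by apply: lt_le_trans (yxle (Ordinal n_gt0)).
have P1 := prod_ge0 _ y g10; have P2 := prod_ge0 _ y g20; have P3 := prod_ge0 _ y g30.
have cP1 := mulr_ge0 c10 P1; have cP2 := mulr_ge0 c20 P2; have cP3 := mulr_ge0 c30 P3.
have xyG := enormB_ge x y.
have yxG := enormB_ge y x; rewrite enormBC in yxG.
rewrite -/r in xyG yxG.
have main : w y `^ p / (enorm (x - y) `^ (n%:R - alpha) * enorm y `^ s) <=
    C `^ p * (enorm y `^ (- A) * enorm (x - y) `^ (- (N - alpha))).
  have -> : enorm y `^ (- A) = enorm y `^ (- (p * t)) * enorm y `^ (- s).
    by rewrite -powRDgt0//; congr (_ `^ _); rewrite /A; ring.
  rewrite invfM -!powRN -/N.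
  set S := enorm y `^ (- s); set X := enorm (x - y) `^ _; set Y := enorm y `^ _.
  have -> : C `^ p * (Y * S * X) = C `^ p * Y * (X * S) by ring.
  rewrite ler_wpM2r ?mulr_ge0 ?powR_ge0// {S X}/Y.
  apply: (@le_trans _ _ ((C * (1 + enorm y) `^ (- t)) `^ p)).
    by apply: le_powRl => //; exact: ltW.
  rewrite powRM ?powR_ge0// ler_wpM2l ?powR_ge0// -powRrM mulNr [t * p]mulrC.
  by apply: ge_powRNl; rewrite ?mulr_ge0 ?(ltW p_gt0)//; lra.
(* Near [x]: [|y| >= r / 2], and the singularity of the kernel is integrated. *)
have [near_x|far_x] := ltP (enorm (x - y)) (r / 2).
  apply: (le_trans main); apply: (@le_trans _ _ (c1 * \prod_i g1 i (y 0 i))).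
    rewrite /c1 -mulrA ler_wpM2l ?powR_ge0// ler_pM ?powR_ge0//.
      by apply: ge_powRNl; rewrite ?(ltW A0)//; lra.
    rewrite (eq_bigr (fun i => `|y 0 i - x 0 i| `^ (- ((N - alpha) / N)))); last first.
      by move=> i _; rewrite /g1 ifT// (le_lt_trans (yxle i)).
    by apply: powR_prod_le => // i; rewrite yxi0/=.
  by rewrite lerDl addr_ge0.
have [near_0|far_0] := ltP (enorm y) (2 * r).
  apply: (le_trans main); apply: (@le_trans _ _ (c2 * \prod_i g2 i (y 0 i))).
    rewrite /c2 [_ * enorm _ `^ _]mulrC -mulrA ler_wpM2l ?powR_ge0// ler_pM ?powR_ge0//.
      by apply: ge_powRNl; rewrite ?(ltW na0).
    rewrite (eq_bigr (fun i => `|y 0 i| `^ (- (A / N)))); last first.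
      by move=> i _; rewrite /g2 subr0 ifT// (le_lt_trans (normr_le_enorm y i)).
    by apply: powR_prod_le => // i; rewrite yi0/= normr_le_enorm.
  by rewrite addrCA lerDl addr_ge0.
(* Far away: both [|y|] and [|x - y|] are at least [(r + |y|) / 4]. *)
apply: (le_trans main); apply: (@le_trans _ _ (c3 * \prod_i g3 i (y 0 i))).
  have ry0 : 0 < r + enorm y by rewrite addr_gt0.
  rewrite /c3 -mulrA ler_wpM2l ?powR_ge0//.
  apply: (@le_trans _ _ (4^-1 `^ (- E) * (r + enorm y) `^ (- E))); last first.
    rewrite ler_wpM2l ?powR_ge0//.
    by apply: powR_prod_le => // i; rewrite ltr_wpDr//= lerD2l normr_le_enorm.
  rewrite -powRM ?(ltW ry0)//.
  have z0 : 0 < 4^-1 * (r + enorm y) by rewrite mulr_gt0.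
  have -> : (4^-1 * (r + enorm y)) `^ (- E) =
      (4^-1 * (r + enorm y)) `^ (- A) * (4^-1 * (r + enorm y)) `^ (- (N - alpha)).
    by rewrite -powRDgt0//; congr (_ `^ _); rewrite /E; ring.
  rewrite ler_pM ?powR_ge0// ge_powRNl ?(ltW A0) ?(ltW na0)//.
    by lra.
  by lra.
by rewrite addrA lerDr addr_ge0.
Qed.
End upper_bounds.

(** * From decay at infinity to bounds on the whole space *)

Section decay.
Context {R : realType} {n : nat}.

Lemma decay_le_global (f : 'rV[R]_n -> R) (C t r0 m : R) : 0 <= t ->
  (forall x, f x <= m) -> (forall x, r0 < enorm x -> f x <= C * enorm x `^ (- t)) ->
  exists C', forall x, f x <= C' * (1 + enorm x) `^ (- t).
Proof.
(* Beyond this radius, which is at least 1, [1 + |x| <= 2 * |x|]; inside it the bound [m]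
   suffices. *)
move=> t0 fm fC; pose r := 1 + `|r0|.
exists (`|C| * 2 `^ t + `|m| * (1 + r) `^ t) => x.
have e0 := enorm_ge0 x; have x1 : 0 < 1 + enorm x by rewrite ltr_wpDr.
have r00 := ler_norm r0; have r01 := normr_ge0 r0.
have [xr|xr] := ltP r (enorm x).
  have xr0 : r0 < enorm x by rewrite /r in xr; lra.
  apply: le_trans (fC x xr0) _.
  apply: (@le_trans _ _ (`|C| * enorm x `^ (- t))).
    by rewrite ler_wpM2r ?powR_ge0// ler_norm.
  apply: (@le_trans _ _ (`|C| * 2 `^ t * (1 + enorm x) `^ (- t))); last first.
    by rewrite ler_wpM2r ?powR_ge0// lerDl mulr_ge0 ?powR_ge0.
  rewrite -mulrA ler_wpM2l//.
  have -> : (2 : R) `^ t = 2^-1 `^ (- t) by rewrite -[2^-1]powR_inv1// -powRrM mulrNN mul1r.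
  rewrite -powRM ?(ltW x1)//; apply: ge_powRNl => //; first by rewrite mulr_gt0.
  by rewrite /r in xr; lra.
apply: le_trans (fm x) _.
apply: (@le_trans _ _ (`|m| * (1 + r) `^ t * (1 + enorm x) `^ (- t))); last first.
  by rewrite ler_wpM2r ?powR_ge0// lerDr mulr_ge0 ?powR_ge0.
apply: (le_trans (ler_norm m)); rewrite -mulrA ler_peMr// powRN ler_pdivlMr ?powR_gt0// mul1r.
by apply: le_powRl => //; [exact: ltW|rewrite lerD2l].
Qed.

Lemma decay_ge_global (f : 'rV[R]_n -> R) (c c1 t t1 r0 : R) : 0 <= t -> 0 <= t1 ->
  0 < c -> 0 < c1 ->
  (forall x, r0 < enorm x -> c * enorm x `^ (- t) <= f x) ->
  (forall x, c1 * (1 + enorm x) `^ (- t1) <= f x) ->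
  exists2 c', 0 < c' & forall x, c' * (1 + enorm x) `^ (- t) <= f x.
Proof.
move=> t0 t10 c0 c10 fc fc1; pose r := 1 + `|r0|.
have r00 := ler_norm r0; have r01 := normr_ge0 r0.
have r1 : 0 < 1 + r by rewrite /r; lra.
pose d := c1 * (1 + r) `^ (- t1).
have d0 : 0 < d by rewrite mulr_gt0// powR_gt0.
exists (Num.min c d); first by rewrite lt_min c0.
move=> x; have e0 := enorm_ge0 x; have x1 : 0 < 1 + enorm x by rewrite ltr_wpDr.
have [xr|xr] := ltP r (enorm x).
  have xr0 : r0 < enorm x by rewrite /r in xr; lra.
  apply: le_trans (fc x xr0).
  apply: ler_pM; rewrite ?powR_ge0 ?le_min ?(ltW c0) ?(ltW d0)//.
    by rewrite ge_min lexx.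
  by apply: ge_powRNl => //; rewrite /r in xr; lra.
apply: le_trans (fc1 x).
apply: (@le_trans _ _ (d * 1)); last first.
  rewrite mulr1 ler_wpM2l ?(ltW c10)//; apply: ge_powRNl => //.
  by rewrite lerD2l.
apply: ler_pM; rewrite ?powR_ge0 ?le_min ?(ltW c0) ?(ltW d0)//.
  by rewrite ge_min lexx orbT.
by rewrite powRN invf_le1 ?powR_gt0// -[leLHS](powRr0 (1 + enorm x)) ler_powR// lerDl.
Qed.

End decay.

(** * Growth of sequences and bookkeeping of powers *)

Section growth.
Context {R : realType}.

Lemma bernoulli_le (z : R) (k : nat) : 1 <= z -> 1 + k%:R * (z - 1) <= z ^+ k.
Proof.
move=> z1; elim: k => [|k IH]; first by rewrite mul0r addr0 expr0.
rewrite exprS; apply: (@le_trans _ _ (z * (1 + k%:R * (z - 1)))); last first.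
  by rewrite ler_pM2l// (lt_le_trans _ z1).
rewrite -natr1; have : 0 <= k%:R * (z - 1) * (z - 1) by rewrite !mulr_ge0// subr_ge0.
lra.
Qed.

Lemma exprn_unbounded (z a : R) : 1 < z -> exists k : nat, a < z ^+ k.
Proof.
move=> z1; have z0 : 0 < z - 1 by rewrite subr_gt0.
exists (Num.truncn (a / (z - 1))).+1.
apply: lt_le_trans (bernoulli_le _ _ (ltW z1)).
have : a < (Num.truncn (a / (z - 1))).+1%:R * (z - 1).
  by rewrite -ltr_pdivrMr// truncnS_gt.
lra.
Qed.

(** Growth is at least linear, so [a] passes any threshold; beyond a suitable one each step
    multiplies by at least [2 * mu], which beats [D * mu ^+ k]. *)
Lemma superlinear_not_exp (a : nat -> R) (C r D mu : R) :
  0 < a 0%N -> 0 < C -> 1 < r -> 1 <= mu ->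
  (forall k, a k + C * a k `^ r <= a k.+1) ->
  (forall k, a k <= D * mu ^+ k) -> False.
Proof.
move=> a0 C0 r1 mu1 aS aD.
have mu0 : 0 < mu by exact: lt_le_trans mu1.
have r0 : 0 < r by exact: lt_trans r1.
have ainc k : a 0%N <= a k.
  elim: k => // k /le_trans; apply; apply: le_trans (aS k).
  by rewrite lerDl mulr_ge0 ?powR_ge0// ltW.
have agt0 k : 0 < a k by exact: lt_le_trans (ainc k).
pose e := C * a 0%N `^ r.
have e0 : 0 < e by rewrite mulr_gt0// powR_gt0.
have alin k : k%:R * e <= a k.
  elim: k => [|k IH]; first by rewrite mul0r ltW.
  apply: le_trans (aS k); rewrite -natr1 mulrDl mul1r lerD//.
  by rewrite ler_pM2l// le_powRl// ltW.
pose b := (2 * mu / C) `^ (r - 1)^-1.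
pose K := (Num.truncn (b / e)).+1.
have ab k : (K <= k)%N -> b <= a k.
  move=> Kk; apply: le_trans (alin k).
  rewrite -ler_pdivrMr//; apply: le_trans (ltW (truncnS_gt _)) _.
  by rewrite ler_nat.
have grow k : (K <= k)%N -> 2 * mu * a k <= a k.+1.
  move=> Kk; apply: le_trans (aS k); apply: (@le_trans _ _ (C * a k `^ r)); last first.
    by rewrite lerDr ltW.
  have -> : a k `^ r = a k `^ (r - 1) * a k.
    by rewrite -[X in _ * X](powRr1 (ltW (agt0 k))) -powRDgt0// subrK.
  rewrite mulrA ler_pM2r// -ler_pdivrMl// mulrC.
  have -> : 2 * mu / C = b `^ (r - 1).
    rewrite /b -powRrM mulVf ?gt_eqF ?subr_gt0// powRr1//.
    by rewrite divr_ge0 ?mulr_ge0// ltW.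
  by rewrite le_powRl ?powR_ge0 ?ab// subr_ge0 ltW.
have geo j : (2 * mu) ^+ j * a K <= a (K + j)%N.
  elim: j => [|j IH]; first by rewrite expr0 mul1r addn0.
  rewrite addnS; apply: le_trans (grow _ (leq_addr _ _)).
  by rewrite exprS -mulrA ler_pM2l// mulr_gt0.
have [j] := @exprn_unbounded 2 (D * mu ^+ K / a K) (ltr1n _ 2).
apply/negP; rewrite -leNgt ler_pdivlMr//.
rewrite -(@ler_pM2r _ (mu ^+ j)) ?exprn_gt0//.
rewrite mulrAC -exprMn -[leRHS]mulrA -exprD.
exact: le_trans (geo j) (aD _).
Qed.
Lemma powR_cascade (k d l r a e p q b s c : R) :
  0 <= k -> 0 <= d -> 0 <= l -> 0 < r -> 0 <= a ->
  (k * (d * r `^ (- e) * a) `^ q * (l * r) `^ b) `^ p * (l * r) `^ (- s) * r `^ c =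
  (k * d `^ q * l `^ b) `^ p * l `^ (- s) * a `^ (p * q) *
    r `^ (c - s + b * p - e * (p * q)).
Proof.
move=> k0 d0 l0 r0 a0.
have -> : r `^ (c - s + b * p - e * (p * q)) =
    r `^ c * r `^ (- s) * (r `^ b) `^ p * ((r `^ (- e)) `^ q) `^ p.
  by rewrite -!(powRrM r) -!powRDgt0//; congr (_ `^ _); ring.
have -> : a `^ (p * q) = (a `^ q) `^ p by rewrite mulrC powRrM.
rewrite !(powRM _ l0 (ltW r0)) !powRM ?mulr_ge0 ?powR_ge0//.
move: (k `^ p) ((d `^ q) `^ p) (((r `^ (- e)) `^ q) `^ p) ((a `^ q) `^ p)
  ((l `^ b) `^ p) ((r `^ b) `^ p) (l `^ (- s)) (r `^ (- s)) (r `^ c).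
by move=> *; ring.
Qed.
End growth.

(** * The system *)

Section system.
Context {R : realType} {n : nat}.
Variables (p q alpha s1 s2 M : R) (u v : 'rV[R]_n -> R).
Hypotheses (n_gt0 : (0 < n)%N) (p_gt0 : 0 < p) (q_gt0 : 0 < q) (pq_gt1 : 1 < p * q).
Hypotheses (alpha_lt : alpha < n%:R) (s1_ge0 : 0 <= s1) (s2_ge0 : 0 <= s2).
Hypotheses (uM : forall x, u x <= M) (vM : forall x, v x <= M).
Hypotheses (u_eq : riesz_eq alpha s1 q v u) (v_eq : riesz_eq alpha s2 p u v).
Hypotheses (u_gt0 : forall x, 0 < u x) (v_gt0 : forall x, 0 < v x).

(** [Q] is the fixed point of the map on decay orders given by one turn around the system, an affine
    map of slope [p * q]. *)
Lemma q0_le_decay (c t : R) : 0 < c ->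
  (forall x, c * (1 + enorm x) `^ (- t) <= u x) -> q0 alpha p q s1 s2 <= t.
Proof.
move=> c0 cu; set Q := q0 alpha p q s1 s2; rewrite leNgt; apply/negP => tQ.
have pq1 : p * q - 1 != 0 by rewrite gt_eqF// subr_gt0.
have iter k : exists2 c', 0 < c' &
    forall x, c' * (1 + enorm x) `^ (- (Q + (p * q) ^+ k * (t - Q))) <= u x.
  elim: k => [|k [c' c'0 c'u]].
    by exists c => // x; rewrite (_ : _ + _ * _ = t)//; ring.
  have [d d0 dv] := riesz_decay_ge _ _ _ n_gt0 alpha_lt s2_ge0 p_gt0 _ _ _ _ v_eq c'0 c'u.
  have [d' d'0 du] := riesz_decay_ge _ _ _ n_gt0 alpha_lt s1_ge0 q_gt0 _ _ _ _ u_eq d0 dv.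
  exists d' => // x; apply: le_trans (du x).
  rewrite le_eqVlt; apply/orP; left; apply/eqP; congr (_ * _ `^ (- _)).
  by rewrite exprS /Q /q0; field.
(* This many turns make the order [Q + (p * q) ^+ k * (t - Q)] negative. *)
have [k hk] := @exprn_unbounded R (p * q) (Q / (Q - t)) pq_gt1.
have [c' c'0 c'u] := iter k.
have := bounded_decay_exponent_ge0 n_gt0 _ _ _ _ c'0 uM c'u.
move: hk; rewrite ltr_pdivrMr ?subr_gt0//; lra.
Qed.

(** * Growth of the mass on balls *)

Local Notation L := (2 * n%:R + 1 : R).

Let L1 : 1 <= L.
Proof. by rewrite lerDr mulr_ge0. Qed.
Let L0 : 0 < L.
Proof. exact: lt_le_trans L1. Qed.
Let na0 : 0 < n%:R - alpha.
Proof. by rewrite subr_gt0. Qed.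

Let mass (r : R) : \bar R :=
  intRn (fun y => (if enorm y < r then u y `^ p / enorm y `^ s2 else 0)%:E).

Let mass_integrand_ge0 (r : R) (y : 'rV[R]_n) :
  0 <= (if enorm y < r then u y `^ p / enorm y `^ s2 else 0).
Proof. by case: ifP => // _; rewrite divr_ge0 ?powR_ge0. Qed.

(** All of the mass lies within [(L ^+ 2 + 1) * r] of [x]. The range up to [L ^+ 2 * r] is wide
    enough to contain the cube at scale [L * r]. *)
Lemma mass_le_potential (a r : R) x : 0 < r -> (a%:E <= mass r)%E ->
  r <= enorm x <= L ^+ 2 * r ->
  ((L ^+ 2 + 1) * r) `^ (- (n%:R - alpha)) * a <= v x.
Proof.
move=> r0 aJ /andP[rx xr]; rewrite -lee_fin v_eq EFinM.
apply: (@le_trans _ _ ((((L ^+ 2 + 1) * r) `^ (- (n%:R - alpha)))%:E * mass r)%E).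
  by rewrite lee_wpmul2l// lee_fin powR_ge0.
apply: le_trans (@intRnZ_ge _ _ _ _ (powR_ge0 _ _) _) _.
  by move=> y; rewrite lee_fin mass_integrand_ge0.
apply: intRn_le => y.
  by rewrite -EFinM lee_fin mulr_ge0 ?powR_ge0 ?mass_integrand_ge0.
rewrite -EFinM lee_fin; case: ifPn => [yr|_]; last first.
  by rewrite mulr0 divr_ge0 ?mulr_ge0 ?powR_ge0.
have xy0 : 0 < enorm (x - y).
  by apply: lt_le_trans (enormB_ge x y); rewrite subr_gt0 (lt_le_trans yr).
rewrite mulrCA ler_wpM2l ?powR_ge0// invfM.
rewrite ler_wpM2r ?invr_ge0 ?powR_ge0// -powRN ge_powRNl ?(ltW na0)//.
apply: le_trans (enormB_le x y) _; lra.
Qed.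

Lemma mass_gt0 : exists2 a, 0 < a & (a%:E <= mass L)%E.
Proof.
have [c c0 cu] := riesz_ge _ _ _ n_gt0 alpha_lt _ _ u_eq (u_gt0 0).
pose m := (c * (1 + L) `^ (- (n%:R - alpha))) `^ p / L `^ s2.
have L10 : 0 < 1 + L by rewrite addr_gt0.
have m0 : 0 < m by rewrite divr_gt0 ?powR_gt0// mulr_gt0// powR_gt0.
exists m => //; have -> : m = m * 1 `^ n%:R by rewrite powR1 mulr1.
apply: intRn_in_cube_ge => //; first exact: ltW.
  by move=> y; rewrite lee_fin mass_integrand_ge0.
move=> y y1; have /andP[ry yr] := in_cube_enorm _ _ n_gt0 ltr01 y1.
have y0 : 0 < enorm y by exact: lt_trans ry.
rewrite mulr1 in yr.
rewrite lee_fin ifT; last by apply: (le_lt_trans yr); lra.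
rewrite /m ler_pM ?invr_ge0 ?powR_ge0//.
  apply: le_powRl; [exact: ltW|by rewrite mulr_ge0 ?powR_ge0// ltW|].
  apply: le_trans (cu y); rewrite ler_wpM2l ?(ltW c0)//.
  apply: ge_powRNl; [exact: ltW|by rewrite addr_gt0|].
  by rewrite lerD2l; apply: (le_trans yr); lra.
rewrite lef_pV2 ?posrE ?powR_gt0//; apply: le_powRl; rewrite ?enorm_ge0//.
by apply: (le_trans yr); lra.
Qed.

(* Mass on [B_r] bounds [v] below on a cube at scale [L r], which
   bounds [u] below on the cube at scale [r], outside [B_r] but inside [B_(L r)];
   the powers of [r] cancel or help exactly when [n - alpha <= p0]. *)
Lemma mass_step : n%:R - alpha <= p0 alpha p q s1 s2 ->
  exists2 C, 0 < C & forall a r : R, 1 <= r -> 0 < a -> (a%:E <= mass r)%E ->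
    ((a + C * a `^ (p * q))%:E <= mass (L * r))%E.
Proof.
move=> np; have [k k0 kP] := riesz_cube_ge _ _ q n_gt0 alpha_lt s1_ge0.
pose d := (L ^+ 2 + 1) `^ (- (n%:R - alpha)).
have L20 : 0 < L ^+ 2 + 1 by rewrite addr_gt0// exprn_gt0.
have d0 : 0 < d by rewrite powR_gt0.
pose C := (k * d `^ q * L `^ (alpha - s1)) `^ p * L `^ (- s2).
have C0 : 0 < C by rewrite mulr_gt0 ?powR_gt0// !mulr_gt0 ?powR_gt0.
exists C => // a r r1 a0 aJ.
have r0 : 0 < r by exact: lt_le_trans r1.
have Lr0 : 0 < L * r by rewrite mulr_gt0.
pose b := ((L ^+ 2 + 1) * r) `^ (- (n%:R - alpha)) * a.
have b0 : 0 < b by rewrite mulr_gt0// powR_gt0// mulr_gt0.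
have vb y : in_cube (L * r) y -> b `^ q <= v y `^ q.
  move=> yr; have /andP[ry yL] := in_cube_enorm _ _ n_gt0 Lr0 yr.
  apply: le_powRl; [exact: ltW|exact: ltW|].
  apply: mass_le_potential => //; apply/andP; split.
    by apply: le_trans (ltW ry); rewrite ler_peMl// ltW.
  apply: (le_trans yL); rewrite expr2 mulrA ler_wpM2r ?(ltW r0)//.
  by rewrite ler_wpM2r ?(ltW L0)// lerDl.
pose m := k * b `^ q * (L * r) `^ (alpha - s1).
have m0 : 0 < m by rewrite !mulr_gt0// powR_gt0.
have um x : enorm x <= L * r -> m <= u x.
  by move=> xr; apply: (kP v) => //; exact: powR_ge0.
pose m' := m `^ p * (L * r) `^ (- s2).
have m'0 : 0 < m' by rewrite mulr_gt0// powR_gt0.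
(* The surplus power of [r] has exponent [(p * q - 1) * (p0 - (n - alpha))], nonnegative by
   assumption, and [1 <= r]. *)
have Cm : C * a `^ (p * q) <= m' * r `^ n%:R.
  have -> : m' * r `^ n%:R =
      C * a `^ (p * q) * r `^ ((p * q - 1) * (p0 alpha p q s1 s2 - (n%:R - alpha))).
    rewrite /m' /m /b (powRM _ (ltW L20) (ltW r0)) -/d.
    rewrite (powR_cascade _ _ _ _ _ _ _ _ _ _ _ (ltW k0) (ltW d0) (ltW L0) r0 (ltW a0)).
    congr (_ * _ `^ _); rewrite /p0; field.
    by rewrite gt_eqF// subr_gt0.
  rewrite ler_peMr ?mulr_ge0 ?powR_ge0 ?(ltW C0)//.
  rewrite -[leLHS](powRr0 r) ler_powR// mulr_ge0 ?subr_ge0// ltW//.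
(* Ball and annulus are disjoint, so [F1 + F2] stays below the integrand of [mass (L * r)] and
   superadditivity applies. *)
pose F1 (y : 'rV[R]_n) := (if enorm y < r then u y `^ p / enorm y `^ s2 else 0)%:E.
pose F2 (y : 'rV[R]_n) := (if r < enorm y < L * r then u y `^ p / enorm y `^ s2 else 0)%:E.
have F10 y : (0 <= F1 y)%E by rewrite lee_fin mass_integrand_ge0.
have F20 y : (0 <= F2 y)%E.
  by rewrite lee_fin; case: ifP => // _; rewrite divr_ge0 ?powR_ge0.
apply: (@le_trans _ _ (intRn F1 + intRn F2)%E).
  rewrite EFinD; apply: leeD => //; apply: (@le_trans _ _ (m' * r `^ n%:R)%:E).
    by rewrite lee_fin.
  apply: intRn_in_cube_ge => //; first exact: ltW.
  move=> y yr; have /andP[ry yL] := in_cube_enorm _ _ n_gt0 r0 yr.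
  have y0 : 0 < enorm y by exact: lt_trans ry.
  have yLr : enorm y < L * r by apply: (le_lt_trans yL); lra.
  rewrite lee_fin ry yLr /= ler_pM ?powR_ge0//.
    by apply: le_powRl; [exact: ltW|exact: ltW|exact/um/ltW].
  by rewrite -powRN ge_powRNl// ltW.
apply: le_trans (intRnD_ge _ _ _ F10 F20) _.
apply: intRn_le => y; first exact: adde_ge0.
rewrite /F1 /F2 -EFinD lee_fin.
have rLr : r <= L * r by rewrite ler_peMl// ltW.
case: (ltgtP (enorm y) r) => yr /=.
- by rewrite addr0 (lt_le_trans yr rLr).
- by rewrite add0r.
- by rewrite addr0 mass_integrand_ge0.
Qed.

Lemma p0_lt_kernel : p0 alpha p q s1 s2 < n%:R - alpha.
Proof.
rewrite ltNge; apply/negP => np.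
have [C C0 step] := mass_step np.
have [a0 a00 a0J] := mass_gt0.
pose a := fix a k := if k is k'.+1 then a k' + C * a k' `^ (p * q) else a0.
have agt0 k : 0 < a k.
  by elim: k => //= k IH; rewrite addr_gt0// mulr_gt0// powR_gt0.
have aJ k : ((a k)%:E <= mass (L ^+ k.+1))%E.
  elim: k => [|k IH]; first by rewrite expr1.
  by rewrite exprS; apply: step => //; exact: exprn_ege1.
pose mu := L `^ (n%:R - alpha).
(* The extra factor [mu] accounts for [a k] being the mass at radius [L ^+ k.+1] rather than
   [L ^+ k]. *)
pose D := M * (L ^+ 2 + 1) `^ (n%:R - alpha) * mu.
apply: (@superlinear_not_exp _ a C (p * q) D mu) => //.
  by rewrite -[leLHS](powRr0 L) ler_powR// ltW.
move=> k; pose r := L ^+ k.+1.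
have r0 : 0 < r by exact: exprn_gt0.
pose x : 'rV[R]_n := const_mx r.
have xr : r <= enorm x <= L ^+ 2 * r.
  apply/andP; split.
    by have := normr_le_enorm x (Ordinal n_gt0); rewrite mxE ger0_norm// ltW.
  apply: (@le_trans _ _ (n%:R * r)).
    by apply: enorm_le_coord => i; rewrite mxE ger0_norm// ltW.
  rewrite ler_pM2r//; apply: (@le_trans _ _ L); last first.
    by rewrite expr2 ler_peMr// ltW.
  by have : 0 <= n%:R :> R by []; lra.
have := le_trans (mass_le_potential _ _ _ r0 (aJ k) xr) (vM x).
have L20 : 0 < L ^+ 2 + 1 by rewrite addr_gt0// exprn_gt0.
rewrite powRN mulrC ler_pdivrMr ?powR_gt0 ?mulr_gt0//.
move=> /le_trans; apply; rewrite /D -!mulrA -exprS powRM ?(ltW L20) ?(ltW r0)//.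
have -> : r `^ (n%:R - alpha) = mu ^+ k.+1.
  by rewrite /r /mu -(powR_mulrn _ (ltW L0)) -(powR_mulrn _ (powR_ge0 _ _)) powRAC.
by [].
Qed.

(** * Fast decay, integrability and the exact rate *)

Hypotheses (alpha_gt0 : 0 < alpha) (s1_lt : s1 < alpha) (s2_lt : s2 < alpha).

Lemma q0_gt0 : 0 < q0 alpha p q s1 s2.
Proof.
rewrite /q0 divr_gt0 ?subr_gt0//.
by rewrite mulrDr mulr1 ltrD// ltr_pM2r.
Qed.

Lemma p0_gt0 : 0 < p0 alpha p q s1 s2.
Proof.
rewrite /p0 divr_gt0 ?subr_gt0//.
by rewrite mulrDr mulr1 ltrD// ltr_pM2r.
Qed.

(** The two critical orders correspond under one equation: order [q0] for [u] is turned into order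
    [p0] for [v]. *)
Lemma p_q0 : p * q0 alpha p q s1 s2 = p0 alpha p q s1 s2 + alpha - s2.
Proof. by rewrite /q0 /p0; field; rewrite gt_eqF// subr_gt0. Qed.

Lemma fast_decay_integrable (C t : R) : q0 alpha p q s1 s2 < t ->
  (forall x, u x <= C * (1 + enorm x) `^ (- t)) -> integrable_sol alpha p q s1 s2 u v.
Proof.
move=> qt uC; have Q0 := q0_gt0; have P0 := p0_gt0; have pQ := p_q0.
set Q := q0 _ _ _ _ _ in qt Q0 pQ; set P := p0 _ _ _ _ _ in P0 pQ.
have PN : P < n%:R - alpha.
  exact: p0_lt_kernel.
have C0 : 0 < C.
  have := lt_le_trans (u_gt0 0) (uC 0); rewrite pmulr_lgt0// powR_gt0//.
  by rewrite ltr_wpDr// enorm_ge0.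
(* At order [z] one has [p * z + s2 = n], the limit of [riesz_decay_le]; [p0 < n - alpha] says
   exactly [Q < z]. The decay of [u] is weakened to an order [t'] strictly between, which still
   gives [v] an order above [P]. *)
pose z := (n%:R - s2) / p.
have Qz : Q < z by rewrite /z ltr_pdivlMr// mulrC pQ; lra.
pose t' := Num.min t ((Q + z) / 2).
have Qt' : Q < t' by rewrite /t' lt_min qt /=; lra.
have t'0 : 0 < t' by exact: lt_trans Qt'.
have t'z : t' < z by rewrite /t' gt_min; apply/orP; right; lra.
have uC' x : u x <= C * (1 + enorm x) `^ (- t').
  apply: le_trans (uC x) _; rewrite ler_wpM2l ?(ltW C0)// ler_powR ?lerDl ?enorm_ge0//.
  by rewrite lerN2 /t' ge_min lexx.
have pt'1 : P < p * t' + s2 - alpha.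
  have : p * Q < p * t' by rewrite ltr_pM2l.
  lra.
have pt'2 : p * t' + s2 < n%:R.
  have : t' * p < n%:R - s2 by rewrite -ltr_pdivlMr.
  lra.
have u0 x : 0 <= u x by exact: ltW.
have v0 x : 0 <= v x by exact: ltW.
split; first exact: (@in_Lp_decay _ _ n_gt0 _ C t').
have at' : alpha < p * t' + s2 by lra.
have [C' vC'] := riesz_decay_le n_gt0 _ _ _ alpha_gt0 alpha_lt p_gt0
  _ _ _ _ v_eq u0 uC' (ltW t'0) at' pt'2.
have b0 : 0 <= p * t' + s2 - alpha by lra.
have [D vD] := decay_le_global _ _ _ _ _ b0 vM vC'.
exact: (@in_Lp_decay _ _ n_gt0 _ D (p * t' + s2 - alpha)).
Qed.

(** The lower half of the asymptotics forces [q0 <= t]; if [q0 < t], the upper half would make the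
    solution integrable. *)
Lemma decaying_rate (t : R) : 0 < t -> ~ integrable_sol alpha p q s1 s2 u v ->
  asym_eq u (fun x => enorm x `^ (- t)) -> t = q0 alpha p q s1 s2.
Proof.
move=> t0 nint [c [C [r0 [c0 [C0 uc]]]]].
have [c1 c10 uc1] := riesz_ge _ _ _ n_gt0 alpha_lt _ _ u_eq (u_gt0 0).
have [c2 c20 uc2] := decay_ge_global _ _ _ _ _ _ (ltW t0) (ltW na0) c0 c10
  (fun x h => (uc x h).1) uc1.
apply/eqP; rewrite eq_le; apply/andP; split; last first.
  exact: q0_le_decay c20 uc2.
rewrite leNgt; apply/negP => qt; apply: nint.
have [D uD] := decay_le_global _ _ _ _ _ (ltW t0) uM (fun x h => (uc x h).2).
exact: fast_decay_integrable qt uD.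
Qed.
End system.

(** * Exchange of the two equations, and conclusion *)

Lemma p0_sym (R : realType) (alpha p q s1 s2 : R) :
  p0 alpha p q s1 s2 = q0 alpha q p s2 s1.
Proof. by rewrite /p0 /q0 [q * p]mulrC. Qed.

Lemma integrable_sol_sym (R : realType) n (alpha p q s1 s2 : R) (u v : 'rV[R]_n -> R) :
  integrable_sol alpha q p s2 s1 v u -> integrable_sol alpha p q s1 s2 u v.
Proof. by rewrite /integrable_sol !p0_sym => -[]. Qed.

Theorem theorem1p5 (R : realType) (n : nat) (p q alpha s1 s2 : R)
  (u v : 'rV[R]_n -> R) :
  (3 <= n)%N -> 0 < p -> 0 < q -> 1 < p * q ->
  0 < alpha -> alpha < n%:R ->
  0 <= s1 -> s1 < alpha -> 0 <= s2 -> s2 < alpha ->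
  measurable_Rn u -> measurable_Rn v ->
  (forall x, 0 < u x) -> (forall x, 0 < v x) ->
  (exists M : R, forall x, u x <= M /\ v x <= M) ->
  is_solution alpha p q s1 s2 u v ->
  [/\
  (* (i) *)
    (forall th1 th2 : R, th1 < q0 alpha p q s1 s2 -> th2 < p0 alpha p q s1 s2 ->
      ~ (exists c : R, 0 < c /\
          ((forall x, c * (1 + enorm x) `^ (- th1) <= u x) \/
           (forall x, c * (1 + enorm x) `^ (- th2) <= v x)))),
  (* (ii) *)
    (~ integrable_sol alpha p q s1 s2 u v ->
     forall th3 th4 : R, q0 alpha p q s1 s2 < th3 -> p0 alpha p q s1 s2 < th4 ->
      ~ (exists C : R, 0 < C /\
          ((forall x, u x <= C * (1 + enorm x) `^ (- th3)) \/
           (forall x, v x <= C * (1 + enorm x) `^ (- th4)))))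
  &
  (* (iii) *)
    (~ integrable_sol alpha p q s1 s2 u v -> decaying u v ->
      asym_eq u (fun x => enorm x `^ (- q0 alpha p q s1 s2)) /\
      asym_eq v (fun x => enorm x `^ (- p0 alpha p q s1 s2)))].
Proof.
move=> n3 p_gt0 q_gt0 pq_gt1 alpha_gt0 alpha_lt s1_ge0 s1_lt s2_ge0 s2_lt _ _.
move=> u_gt0 v_gt0 [M uvM] [u_eq v_eq].
have n_gt0 : (0 < n)%N by exact: leq_trans n3.
have uM x : u x <= M := (uvM x).1.
have vM x : v x <= M := (uvM x).2.
have qp_gt1 : 1 < q * p by rewrite mulrC.
split.
- move=> th1 th2 lt1 lt2 [c [c0 [uc|vc]]].
    move: lt1; apply/negP; rewrite -leNgt.
    by apply: (@q0_le_decay _ _ _ _ _ _ _ M u v _ _ _ _ _ _ _ _ _ _ c).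
  (* Here and below, the claims on [v] are those on [u] for the system with [p], [q] and [s1], [s2]
     exchanged. *)
  move: lt2; apply/negP; rewrite -leNgt p0_sym.
  by apply: (@q0_le_decay _ _ _ _ _ _ _ M v u _ _ _ _ _ _ _ _ _ _ c).
- move=> nint th3 th4 lt3 lt4 [C [C0 [uC|vC]]]; apply: nint.
    by apply: (@fast_decay_integrable _ _ _ _ _ _ _ M u v _ _ _ _ _ _ _ _ _ _ _ _ _ _ _ C th3).
  rewrite p0_sym in lt4; apply: integrable_sol_sym.
  by apply: (@fast_decay_integrable _ _ _ _ _ _ _ M v u _ _ _ _ _ _ _ _ _ _ _ _ _ _ _ C th4).
move=> nint [th1 [th2 [th10 [th20 [uth vth]]]]]; split.
  rewrite -(@decaying_rate _ _ p q alpha s1 s2 M u v _ _ _ _ _ _ _ _ _ _ _ _ _ _ _ _ th1)//.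
have nint' : ~ integrable_sol alpha q p s2 s1 v u by move=> /integrable_sol_sym.
rewrite p0_sym -(@decaying_rate _ _ q p alpha s2 s1 M v u _ _ _ _ _ _ _ _ _ _ _ _ _ _ _ _ th2)//.
Qed.
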